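(* For every fixed digraph $G$ there is an algorithm that, given $l$ commodity types, demand $d^k_v\in\mathbb{Z}$ for each commodity $k$ and vertex $v$, edge capacities $u_e\in\mathbb{Z}_+$, and convex costs $f_e,g^k_e:\mathbb{Z}\to\mathbb{Z}$ (for each edge $e$ and commodity $k$) presented by evaluation oracles, solves, in time polynomial in $l$ and $\langle d^k_v,u_e,\hat f,\hat g\rangle$, the many-commodity transshipment problem $$\min\ \sum_e\left(f_e\Big(\sum_{k=1}^l x^k_e\Big)+\sum_{k=1}^l g^k_e(x^k_e)\right)$$ subject to $$x^k_e\in\mathbb{Z},\quad \sum_{e\in\delta^+(v)}x^k_e-\sum_{e\in\delta^-(v)}x^k_e=d^k_v,\quad \sum_{k=1}^l x^k_e\le u_e,\quad x^k_e\ge 0$$ for all edges $e$, vertices $v$ and commodities $k=1,\dots,l$.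
   Context: $\delta^+(v)$ and $\delta^-(v)$ are the sets of edges of $G$ entering and leaving vertex $v$, respectively. The variable $x^k_e$ is the flow of commodity $k$ on edge $e$. An evaluation oracle for a function returns its value at any given point. $\hat f$ and $\hat g$ are the maximum absolute values, over the feasible set, of $\sum_e f_e(\sum_{k=1}^l x^k_e)$ and $\sum_e\sum_{k=1}^l g^k_e(x^k_e)$ respectively (they need not be part of the input). $\langle\cdot\rangle$ denotes binary-encoding length, and $\mathbb{Z}_+$ is the set of nonnegative integers. An algorithm solves an integer programming problem if it either finds an optimal solution or concludes that the feasible set is infinite or empty.
   Formalization: The number of arithmetic steps and oracle calls is polynomial in l and the stated encoding length; the bit length of the numbers is polynomial in that plus the largest bit length of a single cost value at a feasible flow, since huge costs may cancel in the sums defining f̂ and ĝ. *)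

(* Defs.v *)
From HB Require Import structures.
From mathcomp Require Import all_boot all_order all_algebra.

Set Implicit Arguments.
Unset Strict Implicit.
Unset Printing Implicit Defensive.

Import Order.TTheory GRing.Theory Num.Theory.
Local Open Scope ring_scope.

(** * The transshipment problem *)

Record digraph := Digraph {
  vertex : finType;
  edge : finType;
  tail : edge -> vertex;
  head : edge -> vertex }.

(* [delta_in], [delta_out] are the paper's delta^+ (entering) and delta^-
   (leaving): the reverse of a frequent convention. *)
Definition delta_in (G : digraph) (v : vertex G) : {set edge G} :=
  [set e | head e == v].

Definition delta_out (G : digraph) (v : vertex G) : {set edge G} :=
  [set e | tail e == v].

Record instance (G : digraph) := Instance {
  ncom : nat;
  demand : 'I_ncom -> vertex G -> int;
  capacity : edge G -> nat;
  fcost : edge G -> int -> int;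
  gcost : 'I_ncom -> edge G -> int -> int }.

Arguments demand {G} i k v : rename.
Arguments gcost {G} i k e z : rename.

(* Three-point form of h (a x + (1 - a) z) <= a h x + (1 - a) h z for integer
   y = a x + (1 - a) z, with the denominator z - x of a cleared. *)
Definition convex (h : int -> int) : Prop :=
  forall x y z : int, x <= y <= z ->
    (z - x) * h y <= (z - y) * h x + (y - x) * h z.

Section Transshipment.
Variables (G : digraph) (I : instance G).

Definition flow := {ffun 'I_(ncom I) -> {ffun edge G -> int}}.

Definition feasible (x : flow) : Prop :=
  [/\ forall k v, \sum_(e in delta_in v) x k e - \sum_(e in delta_out v) x k e
                  = demand I k v,
      forall e, \sum_k x k e <= (capacity I e)%:Z
    & forall k e, 0 <= x k e].

Definition ftotal (x : flow) : int := \sum_e fcost I e (\sum_k x k e).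

Definition gtotal (x : flow) : int := \sum_e \sum_k gcost I k e (x k e).

Definition objective (x : flow) : int :=
  \sum_e (fcost I e (\sum_k x k e) + \sum_k gcost I k e (x k e)).

Definition optimal (x : flow) : Prop :=
  feasible x /\ forall y, feasible y -> objective x <= objective y.

Definition infinite_or_empty : Prop :=
  (forall s : seq flow, exists2 x, feasible x & x \notin s) \/
  (forall x, ~ feasible x).

(* The maximum of |F| over the feasible set, 0 if there is no feasible flow. *)
Definition is_max_abs (F : flow -> int) (m : nat) : Prop :=
  (forall x, feasible x -> (`|F x| <= m)%N) /\
  ((exists2 x, feasible x & `|F x|%N = m) \/
   ((forall x, ~ feasible x) /\ m = 0%N)).

(* Binary encoding length: a sign bit and ceil (log2 (|z| + 1)) digits. *)
Definition bitlen (z : int) : nat := (up_log 2 `|z|.+1).+1.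

Definition input_size (fhat ghat : nat) : nat :=
  (ncom I + \sum_k \sum_v bitlen (demand I k v)
   + \sum_e bitlen (capacity I e) + bitlen fhat + bitlen ghat)%N.

(* The individual costs at a feasible flow are not bounded by the maxima of
   |ftotal| and |gtotal|, as they may cancel in the sums; hence this separate
   bound on the lengths of the numbers an algorithm has to read. *)
Definition feasible_costs_fit (b : nat) : Prop :=
  forall x, feasible x ->
    (forall e, (bitlen (fcost I e (\sum_k x k e)) <= b)%N) /\
    (forall k e, (bitlen (gcost I k e (x k e)) <= b)%N).

End Transshipment.

Arguments ftotal {G} I x.
Arguments gtotal {G} I x.

(** * Algorithms

   A call-by-value functional language over integers and lists, with
   environments and de Bruijn indices.  [Fun t] is a recursive function: in
   [t], index 0 is the argument and index 1 the function itself.  [Case a b c]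
   binds the head (index 0) and the tail (index 1) in [c].  [AskF] and [AskG]
   are the evaluation oracles; the edge is part of the program text (the graph
   is fixed), whereas the commodity is computed at run time. *)

Inductive term (E : Type) : Type :=
| Var of nat
| Fun of term E
| App of term E & term E
| Lit of int
| TAdd of term E & term E
| TSub of term E & term E
| IfLe of term E & term E & term E & term E
| TNil
| TCons of term E & term E
| Case of term E & term E & term E
| AskF of E & term E
| AskG of E & term E & term E.

Arguments Var {E} _.
Arguments Lit {E} _.
Arguments TNil {E}.

Inductive value (E : Type) : Type :=
| VInt of int
| VNil
| VCons of value E & value E
| VClos of seq (value E) & term E.

Arguments VInt {E} _.
Arguments VNil {E}.

(* [eval I w env t r c]: in environment [env], [t] evaluates to [r] in [c]
   steps on [w]-bit integers; there is no evaluation if a computed integer or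
   an oracle answer exceeds [w] bits.  Lists and closures are shared pointers
   and the environment has bounded depth for a given program, so a step is a
   bounded number of pointer operations and at most one addition, subtraction,
   comparison or oracle call.  As there is no multiplication, [c] steps cannot
   produce integers more than [c] bits longer than the inputs, the literals and
   the oracle answers: unit cost hides no superpolynomial computation. *)
Inductive eval (G : digraph) (I : instance G) (w : nat) :
  seq (value (edge G)) -> term (edge G) -> value (edge G) -> nat -> Prop :=
| eval_var env n r :
    onth env n = Some r ->
    eval I w env (Var n) r 1%N
| eval_fun env t :
    eval I w env (Fun t) (VClos env t) 1%N
| eval_app env t1 t2 env' t r2 r c1 c2 c3 :
    eval I w env t1 (VClos env' t) c1 ->
    eval I w env t2 r2 c2 ->
    eval I w (r2 :: VClos env' t :: env') t r c3 ->
    eval I w env (App t1 t2) r (c1 + c2 + c3).+1%N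
| eval_lit env z :
    eval I w env (Lit z) (VInt z) 1%N
| eval_add env t1 t2 z1 z2 c1 c2 :
    eval I w env t1 (VInt z1) c1 ->
    eval I w env t2 (VInt z2) c2 ->
    (bitlen (z1 + z2) <= w)%N ->
    eval I w env (TAdd t1 t2) (VInt (z1 + z2)) (c1 + c2).+1%N
| eval_sub env t1 t2 z1 z2 c1 c2 :
    eval I w env t1 (VInt z1) c1 ->
    eval I w env t2 (VInt z2) c2 ->
    (bitlen (z1 - z2) <= w)%N ->
    eval I w env (TSub t1 t2) (VInt (z1 - z2)) (c1 + c2).+1%N
| eval_ifle env t1 t2 t3 t4 z1 z2 r c1 c2 c3 :
    eval I w env t1 (VInt z1) c1 ->
    eval I w env t2 (VInt z2) c2 ->
    eval I w env (if z1 <= z2 then t3 else t4) r c3 ->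
    eval I w env (IfLe t1 t2 t3 t4) r (c1 + c2 + c3).+1%N
| eval_nil env :
    eval I w env TNil VNil 1%N
| eval_cons env t1 t2 r1 r2 c1 c2 :
    eval I w env t1 r1 c1 ->
    eval I w env t2 r2 c2 ->
    eval I w env (TCons t1 t2) (VCons r1 r2) (c1 + c2).+1%N
| eval_case_nil env t1 t2 t3 r c1 c2 :
    eval I w env t1 VNil c1 ->
    eval I w env t2 r c2 ->
    eval I w env (Case t1 t2 t3) r (c1 + c2).+1%N
| eval_case_cons env t1 t2 t3 r1 r2 r c1 c3 :
    eval I w env t1 (VCons r1 r2) c1 ->
    eval I w (r1 :: r2 :: env) t3 r c3 ->
    eval I w env (Case t1 t2 t3) r (c1 + c3).+1%N
| eval_askf env e t z c :
    eval I w env t (VInt z) c ->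
    (bitlen (fcost I e z) <= w)%N ->
    eval I w env (AskF e t) (VInt (fcost I e z)) c.+1
| eval_askg env e t1 t2 (k : 'I_(ncom I)) z c1 c2 :
    eval I w env t1 (VInt (val k)%:Z) c1 ->
    eval I w env t2 (VInt z) c2 ->
    (bitlen (gcost I k e z) <= w)%N ->
    eval I w env (AskG e t1 t2) (VInt (gcost I k e z)) (c1 + c2).+1%N.

Definition vlist (E : Type) (s : seq (value E)) : value E :=
  foldr (@VCons E) VNil s.

(* Vertices, edges and commodities are listed in the order of [enum]. *)
Definition input (G : digraph) (I : instance G) : seq (value (edge G)) :=
  [:: VInt (ncom I);
      vlist [seq vlist [seq VInt (demand I k v) | v <- enum (vertex G)]
            | k <- enum 'I_(ncom I)];
      vlist [seq VInt (capacity I e)%:Z | e <- enum (edge G)]].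

Definition flow_output (G : digraph) (I : instance G) (x : flow I) :
    value (edge G) :=
  vlist [seq vlist [seq VInt (x k e) | e <- enum (edge G)]
        | k <- enum 'I_(ncom I)].

(* The answer [VInt 0], which encodes no flow, stands for the conclusion that
   the feasible set is infinite or empty. *)
Definition solves (G : digraph) (I : instance G) (r : value (edge G)) : Prop :=
  (exists2 x : flow I, optimal x & r = flow_output x) \/
  (infinite_or_empty I /\ r = VInt 0).

(* Main.v *)
Require Import Defs.
From Stdlib Require Import Classical.
From mathcomp Require Import all_boot all_order all_algebra zify.

Set Implicit Arguments.
Unset Strict Implicit.
Unset Printing Implicit Defensive.

Import Order.TTheory GRing.Theory Num.Theory.
Local Open Scope ring_scope.

(** The capacities bound every feasible flow, so the feasible set is finite, and
the program only has to find an optimal flow or to detect that there is none.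
It does so by augmentation.

A state has one row of integers per commodity, indexed by the edges and, for
the first phase, by the vertices, where an artificial entry makes up for
missing demand.  Two states that meet the same demands differ by rows of a
lattice that depends on the digraph only.  By Dickson's lemma this lattice has
a finite set of generators such that every element of the lattice is a sum of
generators without cancellation ([conformal_basis]; this is its Graver basis).  The difference of two states is
thus a sum of pairs of a commodity and a generator.  The objective also involves
the sums over the commodities, where these pairs may cancel.  Dickson's lemma
for multisets of generators shows that the pairs can be grouped into blocks of
at most K pairs whose total does not cancel either ([block_decomposition]).
The bound K depends on the digraph only, because only the generators in a block
matter for its total, not the commodities that carry them.

Hence there are polynomially many distinct blocks.  A separable convex function
is superadditive along a decomposition without cancellation, so one of the
blocks, with its multiplicity rounded down to a power of two, closes a
polynomial fraction of the gap between the current state and any better one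
([augmenting_block]).  Trying all blocks with all relevant powers of two and
keeping the best result therefore reaches an optimum after a number of rounds
that is polynomial in the length of the initial gap ([descend_converges]).

The first phase starts with all demand on the artificial entries and minimises
a convex penalty that vanishes exactly at the feasible flows.  The second phase
minimises the objective among the states of penalty 0, so that the oracles are
only asked for costs at feasible flows, where the answers are short.

For the word length it suffices to count steps: an addition or a subtraction
adds at most one bit ([run_eval]), so the program is analysed on a machine with
unbounded integers.  The cost of each function of the program is bounded by an
explicit expression, and the sum of all of them by a polynomial
([main_cost_poly]). *)

(** * Conformal decompositions *)

(** Dickson's lemma, by induction on the coordinates.  The basis obtained for the
other coordinates serves all elements whose first coordinate is at least the
maximum [m] over this basis; each smaller value of the first coordinate gives a
slice to which the induction hypothesis applies. *)
Lemma dickson_seq (A : eqType) (C : Type) (v : A -> C -> nat) (cs : seq C)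
    (P : A -> Prop) :
  exists s : seq A, (forall a, a \in s -> P a) /\
    forall a, P a -> exists2 b, b \in s & all (fun c => v b c <= v a c)%N cs.
Proof.
elim: cs P => [|c cs IH] P.
  case: (classic (exists a, P a)) => [[a Pa]|nP].
    exists [:: a]; split=> [b|b _]; first by rewrite inE => /eqP->.
    by exists a; rewrite ?mem_head.
  by exists [::]; split=> // a Pa; case: nP; exists a.
have [s0 [s0P s0D]] := IH P.
pose m := (\max_(b <- s0) v b c)%N.
have bounded n : exists s : seq A, (forall a, a \in s -> P a) /\
    forall a, P a -> (v a c < n)%N ->
      exists2 b, b \in s & all (fun c => v b c <= v a c)%N (c :: cs).
  elim: n => [|n [s [sP sD]]]; first by exists [::].
  have [s' [s'P s'D]] := IH (fun a => P a /\ v a c = n).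
  exists (s ++ s'); split=> [a|a Pa].
    by rewrite mem_cat => /orP[/sP//|/s'P[]].
  rewrite ltnS leq_eqVlt => /orP[/eqP van|/(sD a Pa)[b bs le_ba]].
    have [b bs' le_ba] := s'D a (conj Pa van).
    exists b; first by rewrite mem_cat bs' orbT.
    by rewrite /= le_ba; have [_ ->] := s'P b bs'; rewrite van leqnn.
  by exists b; rewrite // mem_cat bs.
have [s [sP sD]] := bounded m.
exists (s0 ++ s); split=> [a|a Pa].
  by rewrite mem_cat => /orP[/s0P//|/sP].
have [lt_am|le_ma] := ltnP (v a c) m.
  have [b bs le_ba] := sD a Pa lt_am.
  by exists b; rewrite // mem_cat bs orbT.
have [b bs0 le_ba] := s0D a Pa.
exists b; first by rewrite mem_cat bs0.
rewrite /= le_ba andbT (leq_trans _ le_ma) // /m.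
exact: (leq_bigmax_seq b).
Qed.

(** [a] and [b - a] do not have opposite signs: [a] may occur in a decomposition of
[b] without cancellation. *)
Definition conf (a b : int) : bool := (0 <= a <= b) || (b <= a <= 0).

Definition npos (z : int) : nat := if z is Posz n then n else 0%N.
Definition nneg (z : int) : nat := if z is Negz n then n.+1 else 0%N.

(** Expresses conformality as domination of natural numbers, the order of Dickson's
lemma. *)
Lemma conf_parts a b :
  conf a b = (npos a <= npos b)%N && (nneg a <= nneg b)%N.
Proof. rewrite /conf /npos /nneg; case: a => a; case: b => b; lia. Qed.

Lemma conf_subr a b c : conf a b -> conf c (b - a) -> conf c b.
Proof. rewrite /conf; lia. Qed.

Lemma conf_dist a b : conf a b -> (`|b - a| <= `|b|)%N.
Proof. rewrite /conf; lia. Qed.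

Lemma conf_distS a b : a != 0 -> conf a b -> (`|b - a| < `|b|)%N.
Proof. rewrite /conf; lia. Qed.

(** Without cancellation, partial sums lie between 0 and the total. *)
Lemma conf_sum (A : eqType) (s1 s2 : seq A) (F : A -> int) z :
    (forall a, a \in s1 ++ s2 -> conf (F a) z) ->
    \sum_(a <- s1 ++ s2) F a = z ->
  conf (\sum_(a <- s1) F a) z.
Proof.
move=> Fz; rewrite big_cat /=.
have Fz1 a : a \in s1 -> conf (F a) z by move=> sa; apply: Fz; rewrite mem_cat sa.
have Fz2 a : a \in s2 -> conf (F a) z.
  by move=> sa; apply: Fz; rewrite mem_cat sa orbT.
have [z0|z0] := lerP 0 z.
  have half s : (forall a, a \in s -> conf (F a) z) -> 0 <= \sum_(a <- s) F a.
    by move=> sF; rewrite big_seq; apply: sumr_ge0 => a /sF; rewrite /conf; lia.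
  move: (half _ Fz1) (half _ Fz2); move: (\sum_(a <- s1) _) => u.
  by move: (\sum_(a <- s2) _) => v; rewrite /conf; lia.
have half s : (forall a, a \in s -> conf (F a) z) -> \sum_(a <- s) F a <= 0.
  by move=> sF; rewrite big_seq; apply: sumr_le0 => a /sF; rewrite /conf; lia.
move: (half _ Fz1) (half _ Fz2); move: (\sum_(a <- s1) _) => u.
by move: (\sum_(a <- s2) _) => v; rewrite /conf; lia.
Qed.

Section ConformalBasis.
Variable T : finType.
Notation row := {ffun T -> int}.

(** The finitely many elements that Dickson's lemma selects among the nonzero ones
generate: as long as [z] is nonzero, one of them can be subtracted from [z]
without changing any sign, and the sum of the absolute values decreases. *)
Lemma conformal_basis (L : row -> Prop) :
    (forall a b, L a -> L b -> L (a - b)) ->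
  exists2 G : seq row, (forall g, g \in G -> L g) &
    forall z, L z -> exists q : seq row,
      [/\ {subset q <= G}, forall g, g \in q -> forall t, conf (g t) (z t)
        & \sum_(g <- q) g = z].
Proof.
move=> LB.
pose v (g : row) (c : T * bool) := if c.2 then npos (g c.1) else nneg (g c.1).
have [G [GL GD]] := dickson_seq v (enum {: T * bool}) (fun g => L g /\ g <> 0).
exists G => [g /GL[]//|z].
have [n] := ubnP (\sum_t `|z t|)%N; elim: n z => // n IH z zn Lz.
have [->|/eqP z0] := eqVneq z 0.
  by exists [::]; split=> //; rewrite big_nil.
have [g gG /allP le_gz] := GD z (conj Lz z0).
have gz t : conf (g t) (z t).
  rewrite conf_parts (le_gz (t, true)) ?mem_enum //.
  by rewrite (le_gz (t, false)) ?mem_enum.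
have [Lg g0] := GL g gG.
have [|q [qG qz qE]] := IH (z - g) _ (LB _ _ Lz Lg).
  have [t gt0] : exists t, g t != 0.
    apply/existsP; apply: contra_notT g0; rewrite negb_exists => /forallP g0.
    by apply/ffunP => t; rewrite ffunE; have /negbNE/eqP := g0 t.
  apply: leq_trans (zn : (_ <= n)%N).
  rewrite (bigD1 t) //= [X in (_ < X)%N](bigD1 t) //= -addSn leq_add //.
    by rewrite !ffunE conf_distS.
  by apply: leq_sum => i _; rewrite !ffunE conf_dist.
exists (g :: q); split=> [h|h|]; rewrite ?inE.
- by case/predU1P=> [->|/qG].
- case/predU1P=> [-> //|/qz hz] t; apply: conf_subr (gz t) _.
  by have := hz t; rewrite !ffunE.
- by rewrite big_cons qE addrC subrK.
Qed.

(** Dickson's lemma for the lists [q] of generators, with the multiplicities and the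
positive and negative parts of the sum as coordinates: a list below [q] is a
submultiset of [q] whose sum is conformal to the sum of [q]. *)
Lemma conformal_block (G : seq row) :
  exists K : nat, forall q : seq row, {subset q <= G} -> q <> [::] ->
    exists q' : seq row, [/\ q' <> [::], (size q' <= K)%N,
      forall g, (count_mem g q' <= count_mem g q)%N
      & forall t, conf (\sum_(g <- q') g t) (\sum_(g <- q) g t)].
Proof.
pose v (q : seq row) (c : row + T * bool) := match c with
  | inl g => count_mem g q
  | inr (t, b) => if b then npos (\sum_(g <- q) g t) else nneg (\sum_(g <- q) g t)
  end.
have [B [BP BD]] := dickson_seq v
  ([seq inl g | g <- G] ++ [seq inr c | c <- enum {: T * bool}])
  (fun q => {subset q <= G} /\ q <> [::]).
exists (\max_(q <- B) size q)%N => q qG q0.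
have [q' q'B] := BD q (conj qG q0).
rewrite all_cat 2!all_map => /andP[/allP le_G /allP le_T].
have [q'G q'0] := BP q' q'B.
exists q'; split=> // [|g|t].
- exact: (leq_bigmax_seq q').
- have [gq|gq] := boolP (g \in q'); first exact: le_G (q'G g gq).
  by rewrite (count_memPn gq).
- have inT c : c \in enum {: T * bool} by rewrite mem_enum.
  rewrite conf_parts; apply/andP.
  by split; [exact: le_T (inT (t, true)) | exact: le_T (inT (t, false))].
Qed.

End ConformalBasis.

Lemma extract_map (A B : eqType) (f : A -> B) (q : seq B) (p : seq A) :
    (forall b, count_mem b q <= count_mem b (map f p))%N ->
  exists p1 p2, perm_eq p (p1 ++ p2) /\ map f p1 = q.
Proof.
elim: q p => [|b q IH] p le_qp; first by exists [::], p.
have /mapP[a ap def_b] : b \in map f p.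
  by rewrite -has_pred1 has_count; apply: leq_trans (le_qp b); rewrite /= eqxx.
have [|p1 [p2 [p12 def_q]]] := IH (rem a p).
  move=> c; have := le_qp c; have /permP := perm_map f (perm_to_rem ap).
  by move=> /(_ (pred1 c)) -> /=; rewrite def_b leq_add2l.
exists (a :: p1), p2; rewrite /= -def_b def_q; split=> //.
by rewrite (permPl (perm_to_rem ap)) perm_cons.
Qed.

(** Removing one block leaves a sum that is still conformal to the original one, so
blocks can be removed until nothing is left.  The labels in [I] only follow the
generators, hence [K] does not depend on [I]. *)
Lemma perm_blocks (T : finType) (G : seq {ffun T -> int}) :
  exists K : nat, forall (I : finType) (p : seq (I * {ffun T -> int})),
    {subset map snd p <= G} ->
    exists2 bs : seq (seq (I * {ffun T -> int})), perm_eq p (flatten bs) &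
      forall b, b \in bs -> (size b <= K)%N /\
        forall t, conf (\sum_(x <- b) x.2 t) (\sum_(x <- p) x.2 t).
Proof.
have [K blockK] := conformal_block G; exists K => I p.
have [n] := ubnP (size p); elim: n p => // n IH p pn pG.
have [->|/eqP p0] := eqVneq p [::]; first by exists [::].
have [|q [q0 qK qp qS]] := blockK (map snd p) pG; first by case: (p) p0.
have [p1 [p2 [p12 def_q]]] := extract_map qp.
have sum_p t : \sum_(x <- p) x.2 t = \sum_(x <- p1) x.2 t + \sum_(x <- p2) x.2 t.
  by rewrite (perm_big _ p12) big_cat.
have conf1 t : conf (\sum_(x <- p1) x.2 t) (\sum_(x <- p) x.2 t).
  by have := qS t; rewrite -def_q !big_map.
have [||bs bsp bsP] := IH p2.
- have p1_gt0 : (0 < size p1)%N by rewrite -(size_map snd) def_q lt0n size_eq0; apply/eqP.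
  apply: leq_trans (pn : (_ <= n)%N).
  by rewrite (perm_size p12) size_cat -[X in (X < _)%N]add0n ltn_add2r.
- move=> g /mapP[x xp2 ->]; apply/pG/map_f.
  by rewrite (perm_mem p12) mem_cat xp2 orbT.
exists (p1 :: bs) => [|b].
  by rewrite (permPl p12) /= perm_cat2l.
rewrite inE => /predU1P[-> |/bsP[bK bS]]; split=> //.
  by rewrite -(size_map snd) def_q.
by move=> t; apply: conf_subr (conf1 t) _; rewrite sum_p addrC addKr.
Qed.

(** * Augmentation of separable convex functions *)

Section Augmentation.
Variables (l : nat) (T : finType).
Notation row := {ffun T -> int}.
Notation state := {ffun 'I_l -> row}.
Notation J := (T + 'I_l * T)%type.

(** The quantities of which the objective is a separable function: the sums over
the commodities and the single entries. *)
Definition component (X : state) (j : J) : int :=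
  match j with inl t => \sum_k X k t | inr (k, t) => X k t end.

Definition single (k : 'I_l) (g : row) : state :=
  [ffun i => if i == k then g else 0].

Definition block_sum (b : seq ('I_l * row)) : state :=
  \sum_(x <- b) single x.1 x.2.

Lemma component0 j : component 0 j = 0.
Proof.
case: j => [t|[k t]] /=; last by rewrite !ffunE.
by rewrite big1 // => k _; rewrite !ffunE.
Qed.

Lemma componentD X Y j : component (X + Y) j = component X j + component Y j.
Proof.
case: j => [t|[k t]] /=; last by rewrite !ffunE.
by rewrite -big_split; apply: eq_bigr => k _; rewrite !ffunE.
Qed.

Lemma componentMn X n j : component (X *+ n) j = n%:Z * component X j.
Proof.
elim: n => [|n IH]; first by rewrite component0 mul0r.
by rewrite mulrS componentD IH -[in RHS]add1n PoszD mulrDl mul1r.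
Qed.

Lemma component_sum (A : Type) (s : seq A) (F : A -> state) j :
  component (\sum_(a <- s) F a) j = \sum_(a <- s) component (F a) j.
Proof.
by apply: (big_morph (component^~ j)) => [X Y|]; [exact: componentD | exact: component0].
Qed.

Lemma component_single_row k g t : component (single k g) (inl t) = g t.
Proof.
rewrite /= (bigD1 k) //= !ffunE eqxx big1 ?addr0 // => i /negPf ik.
by rewrite !ffunE ik ffunE.
Qed.

Lemma component_single k g i t :
  component (single k g) (inr (i, t)) = if i == k then g t else 0.
Proof. by rewrite /= ffunE; case: eqP => // _; rewrite ffunE. Qed.

Lemma state_eqP X Y : (forall k t, component X (inr (k, t)) = component Y (inr (k, t))) -> X = Y.
Proof. by move=> XY; apply/ffunP => k; apply/ffunP => t; exact: XY. Qed.

Lemma component_block_row b t : component (block_sum b) (inl t) = \sum_(x <- b) x.2 t.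
Proof. by rewrite component_sum; apply: eq_bigr => x _; exact: component_single_row. Qed.

Lemma component_block b k t :
  component (block_sum b) (inr (k, t)) = \sum_(x <- b) (if k == x.1 then x.2 t else 0).
Proof. by rewrite component_sum; apply: eq_bigr => x _; exact: component_single. Qed.

Lemma perm_block_sum b1 b2 : perm_eq b1 b2 -> block_sum b1 = block_sum b2.
Proof. exact: perm_big. Qed.

Lemma block_sum_flatten bs : block_sum (flatten bs) = \sum_(b <- bs) block_sum b.
Proof. exact: big_flatten. Qed.

End Augmentation.

(** Conformality in the single entries comes from the generators, conformality in
the sums over the commodities from the grouping into blocks. *)
Lemma block_decomposition (T : finType) (L : {ffun T -> int} -> Prop) :
    (forall a b, L a -> L b -> L (a - b)) ->
  exists (G : seq {ffun T -> int}) (K : nat), (forall g, g \in G -> L g) /\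
    forall l (Z : {ffun 'I_l -> {ffun T -> int}}), (forall k, L (Z k)) ->
    exists2 bs, \sum_(b <- bs) block_sum b = Z &
      forall b, b \in bs -> [/\ (size b <= K)%N, {subset map snd b <= G}
        & forall j, conf (component (block_sum b) j) (component Z j)].
Proof.
move=> LB; have [G GL basis] := conformal_basis LB.
have [K blocks] := perm_blocks G; exists G, K; split=> // l Z LZ.
have /fin_all_exists[q qP] k := basis (Z k) (LZ k).
pose p := [seq (k, g) | k <- enum 'I_l, g <- q k].
have sum_p (F : 'I_l * {ffun T -> int} -> int) :
    \sum_(x <- p) F x = \sum_k \sum_(g <- q k) F (k, g).
  by rewrite big_allpairs_dep big_enum.
have sum_q k t : \sum_(g <- q k) g t = Z k t.
  by have [_ _ <-] := qP k; rewrite sum_ffunE.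
have sum_block_p : block_sum p = Z.
  apply: state_eqP => k t; rewrite component_block sum_p (bigD1 k) //= eqxx sum_q.
  rewrite big1 ?addr0 // => i /negPf ik; rewrite big1 // => g _.
  by rewrite eq_sym ik.
have [|bs bsp bsP] := blocks _ p.
  move=> g /mapP[_ /allpairsPdep[k [h [_ qh ->]]] ->].
  by have [qG _ _] := qP k; exact: qG.
exists bs => [|b bbs]; first by rewrite -block_sum_flatten -(perm_block_sum bsp).
have [bK conf_b] := bsP b bbs.
have p_b : perm_eq p (b ++ flatten (rem b bs)).
  by rewrite (permPl bsp); apply: (perm_flatten (perm_to_rem bbs)).
have sub_b : {subset b <= p} by move=> x xb; rewrite (perm_mem p_b) mem_cat xb.
have inP x : x \in p -> x.2 \in q x.1.
  by move=> /allpairsPdep[k [h [_ qh ->]]].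
split=> //.
  move=> g /mapP[x /sub_b/inP xq ->].
  by have [qG _ _] := qP x.1; exact: qG.
case=> [t|[k t]]; first by rewrite -sum_block_p !component_block_row.
rewrite component_block.
apply: (@conf_sum _ _ (flatten (rem b bs))) => [x|].
  rewrite -(perm_mem p_b) => /inP xq; case: eqP => [->|_].
    by have [_ + _] := qP x.1; exact.
  by move: (component Z _) => z; rewrite /conf; lia.
by rewrite -(perm_big _ p_b) -component_block sum_block_p.
Qed.
(** The slope from [x] to [x + p * c] does not decrease as [p] grows. *)
Lemma convex_scale h x c (p q : nat) : convex h -> (p <= q)%N ->
  q%:Z * (h (x + p%:Z * c) - h x) <= p%:Z * (h (x + q%:Z * c) - h x).
Proof.
move=> cvx pq.
have [->|c0] := eqVneq c 0; first by rewrite !mulr0 addr0 subrr !mulr0.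
have [c_gt0|c_le0] := ltrP 0 c.
  have /cvx : x <= x + p%:Z * c <= x + q%:Z * c by nia.
  have -> : x + q%:Z * c - x = q%:Z * c by lia.
  have -> : x + p%:Z * c - x = p%:Z * c by lia.
  have -> : x + q%:Z * c - (x + p%:Z * c) = (q%:Z - p%:Z) * c by nia.
  move: (h x) (h (x + p%:Z * c)) (h (x + q%:Z * c)) => h0 hp hq le_h.
  rewrite -(ler_pM2l c_gt0); nia.
have c_lt0 : 0 < - c by lia.
have /cvx : x + q%:Z * c <= x + p%:Z * c <= x by nia.
have -> : x - (x + q%:Z * c) = - (q%:Z * c) by lia.
have -> : x - (x + p%:Z * c) = - (p%:Z * c) by lia.
have -> : x + p%:Z * c - (x + q%:Z * c) = (q%:Z - p%:Z) * - c by nia.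
move: (h x) (h (x + p%:Z * c)) (h (x + q%:Z * c)) => h0 hp hq le_h.
rewrite -(ler_pM2l c_lt0); nia.
Qed.

(** The increment of [h] along [a] does not decrease when it is taken at [x + b]
instead of [x]: both inner points are convex combinations of the outer ones,
with complementary weights. *)
Lemma convex_exchange h x a b : convex h -> 0 <= a * b ->
  h (x + a) + h (x + b) <= h x + h (x + (a + b)).
Proof.
move=> cvx ab.
have [s0|s0] := eqVneq (a + b) 0.
  have [-> ->] : a = 0 /\ b = 0 by split; nia.
  by rewrite !addr0.
have pos u c d : 0 <= c -> 0 <= d -> 0 < c + d ->
    h (u + c) + h (u + d) <= h u + h (u + (c + d)).
  move=> c0 d0 cd0.
  have /cvx le1 : u <= u + c <= u + (c + d) by lia.
  have /cvx le2 : u <= u + d <= u + (c + d) by lia.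
  rewrite -(ler_pM2l cd0).
  move: (h u) (h (u + c)) (h (u + d)) (h (u + (c + d))) le1 le2 => h0 hc hd hs.
  nia.
have [a0|a0] := lerP 0 a; have [b0|b0] := lerP 0 b; try nia.
- by apply: pos => //; lia.
- have ? : a = 0 by nia.
  by subst a; rewrite !add0r !addr0.
- have ? : b = 0 by nia.
  by subst b; rewrite !addr0 addrC.
have := pos (x + (a + b)) (- a) (- b).
have -> : x + (a + b) + - a = x + b by lia.
have -> : x + (a + b) + - b = x + a by lia.
have -> : x + (a + b) + (- a + - b) = x by lia.
move=> le_h; suff: h (x + b) + h (x + a) <= h (x + (a + b)) + h x by lia.
by apply: le_h; lia.
Qed.

(** Iterates [convex_exchange]: the single steps, each taken from [x], together cost
at most as much as the joint step. *)
Lemma convex_superadd (A : eqType) (h : int -> int) (x z : int) (s : seq A)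
    (F : A -> int) :
  convex h -> (forall a, a \in s -> conf (F a) z) -> \sum_(a <- s) F a = z ->
  \sum_(a <- s) (h (x + F a) - h x) <= h (x + z) - h x.
Proof.
move=> cvx Fz <-.
have [e [ee Fe]] : exists e : int, e * e = 1 /\ forall a, a \in s -> 0 <= e * F a.
  by exists (if 0 <= z then 1 else -1); split=> [|a /Fz]; rewrite /conf; case: ifP; lia.
elim: s Fe {Fz} => [|a s IH] Fe; first by rewrite !big_nil addr0 subrr.
rewrite !big_cons.
have Fe_s b : b \in s -> 0 <= e * F b by move=> bs; apply: Fe; rewrite inE bs orbT.
have {}IH := IH Fe_s.
have := @convex_exchange h x (F a) (\sum_(a <- s) F a) cvx.
have : 0 <= e * \sum_(a <- s) F a.
  by rewrite mulr_sumr big_seq; apply: sumr_ge0.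
have := Fe a (mem_head _ _).
move: (\sum_(a <- s) F a : int) IH => u; move: (\sum_(a <- s) _ : int) (F a) => v w.
move=> le_v ew eu le_u; have wu : 0 <= w * u.
  by rewrite -[w * u]mul1r -ee mulrACA; exact: mulr_ge0.
have combine (p q r t y : int) : y <= q - r -> p + q <= r + t -> p - r + y <= t - r.
  by lia.
exact: combine le_v (le_u wu).
Qed.

Lemma exists_below_average (A : eqType) (s : seq A) (f : A -> int) (m : nat) :
    (size s <= m)%N -> \sum_(a <- s) f a < 0 ->
  exists2 a, a \in s & m%:Z * f a <= \sum_(a <- s) f a.
Proof.
move=> sm; set S := (X in X < 0) => S_lt0; apply: NNPP => none.
have s_gt0 : (0 < size s)%N by case: (s) @S S_lt0 => // S; rewrite /S big_nil.
have : \sum_(a <- s) (S + 1) <= m%:Z * S.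
  rewrite mulr_sumr big_seq [leRHS]big_seq; apply: ler_sum => a sa.
  have : ~ m%:Z * f a <= S by move=> le_fa; apply: none; exists a.
  by move: (_ * f a) => u; lia.
rewrite big_const_seq count_predT iter_addr_0 -mulr_natl.
move: S S_lt0 (size s) sm s_gt0 => S S_lt0 n nm n_gt0; nia.
Qed.

Fixpoint words (A : Type) (n : nat) (s : seq A) : seq (seq A) :=
  [::] :: if n is n'.+1 then [seq a :: w | a <- s, w <- words n' s] else [::].

Lemma size_words (A : Type) n (s : seq A) : (size (words n s) <= (size s).+1 ^ n)%N.
Proof.
elim: n => //= n IH; rewrite size_allpairs expnS.
have : (0 < (size s).+1 ^ n)%N by rewrite expn_gt0.
by move: ((size s).+1 ^ n)%N IH => p; nia.
Qed.

Lemma mem_words (A : eqType) n (s w : seq A) :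
  (size w <= n)%N -> {subset w <= s} -> w \in words n s.
Proof.
elim: n w => [|n IH] [|a w] //= wn ws; rewrite ?mem_head //.
rewrite inE; apply/orP; right; apply/allpairsP; exists (a, w); split=> //=.
  by apply: ws; rewrite mem_head.
by apply: IH => // b bw; apply: ws; rewrite inE bw orbT.
Qed.

(** Counts the distinct blocks: for a fixed length [n], polynomially many in the
size of the alphabet. *)
Lemma uniq_words_size (A : eqType) n (s : seq A) (ws : seq (seq A)) :
    uniq ws -> (forall w, w \in ws -> (size w <= n)%N /\ {subset w <= s}) ->
  (size ws <= (size s).+1 ^ n)%N.
Proof.
move=> uws wsP; apply: leq_trans (size_words n s).
by apply: uniq_leq_size => // w /wsP[]; exact: mem_words.
Qed.

Lemma sum_undup_count (V : nmodType) (A : eqType) (s : seq A) (F : A -> V) :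
  \sum_(a <- undup s) F a *+ count_mem a s = \sum_(a <- s) F a.
Proof.
rewrite -[RHS](perm_big _ (perm_count_undup s)) big_flatten big_map /=.
by apply: eq_bigr => a _; rewrite big_nseq iter_addr_0.
Qed.

Section AugmentingBlock.
Variables (l : nat) (T : finType).
Notation row := {ffun T -> int}.
Notation state := {ffun 'I_l -> row}.
Notation J := (T + 'I_l * T)%type.

Definition energy (phi : J -> int -> int) (X : state) : int :=
  \sum_j phi j (component X j).

Lemma energy_scale phi X W (p q : nat) : (forall j, convex (phi j)) -> (p <= q)%N ->
  q%:Z * (energy phi (X + W *+ p) - energy phi X)
    <= p%:Z * (energy phi (X + W *+ q) - energy phi X).
Proof.
move=> cvx pq; rewrite /energy -!sumrB !mulr_sumr; apply: ler_sum => j _.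
by rewrite !componentD !componentMn; exact: convex_scale.
Qed.

(** A nonnegative convex function that vanishes at two points vanishes in between. *)
Lemma energy_between psi X W (p q : nat) : (forall j, convex (psi j)) ->
    (forall j z, 0 <= psi j z) -> (p <= q)%N ->
    energy psi X <= 0 -> energy psi (X + W *+ q) <= 0 ->
  energy psi (X + W *+ p) <= 0.
Proof.
move=> cvx psi0 pq X0 Y0; have [q0|q0] := posnP q.
  by move: pq Y0; rewrite q0 leqn0 => /eqP->.
have := energy_scale X W cvx pq.
have ge0 Z : 0 <= energy psi Z by apply: sumr_ge0.
have -> : energy psi X = 0 by apply: le_anti; rewrite X0 ge0.
have -> : energy psi (X + W *+ q) = 0 by apply: le_anti; rewrite Y0 ge0.
by rewrite !subr0 mulr0 pmulr_rle0.
Qed.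

(** Every component of [X + W] lies between those of [X] and [X + Z]. *)
Lemma energy_conf_le psi X W Z : (forall j, convex (psi j)) ->
    (forall j z, 0 <= psi j z) -> (forall j, conf (component W j) (component Z j)) ->
    energy psi X <= 0 -> energy psi (X + Z) <= 0 ->
  energy psi (X + W) <= 0.
Proof.
move=> cvx psi0 WZ X0 Y0.
have term0 V j : energy psi V <= 0 -> psi j (component V j) = 0.
  move=> V0; have : energy psi V == 0 by rewrite eq_le V0 sumr_ge0.
  by rewrite psumr_eq0 // => /allP/(_ j); rewrite mem_index_enum => /(_ isT)/eqP.
rewrite /energy; apply: sumr_le0 => j _; rewrite componentD.
have := term0 _ j Y0; have := term0 _ j X0; rewrite componentD.
move: (component X j) (component W j) (component Z j) (WZ j) => x w z; rewrite /conf.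
have [->|z0] := eqVneq z 0.
  move=> w0 psix _; have -> : w = 0 by lia.
  by rewrite addr0 psix.
case/orP=> /andP[w1 w2] psix psiz.
  have /(cvx j) : x <= x + w <= x + z by lia.
  rewrite psix psiz !mulr0 addr0 pmulr_rle0 //; lia.
have /(cvx j) : x + z <= x + w <= x by lia.
rewrite psix psiz !mulr0 addr0 pmulr_rle0 //; lia.
Qed.

(** Grouping equal blocks gives a decomposition of [Y - X] into multiples of
distinct blocks, and superadditivity gives one multiple, say [lam b] times [b],
with at least an average share of the gain.  By [convex_scale] the largest power
of two up to [lam b] retains half of this gain. *)
Lemma augmenting_block (G : seq row) (K B : nat) (bs : seq (seq ('I_l * row)))
    (phi psi : J -> int -> int) (X Y : state) :
    (forall j, convex (phi j)) -> (forall j, convex (psi j)) ->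
    (forall j z, 0 <= psi j z) ->
    \sum_(b <- bs) block_sum b = Y - X ->
    (forall b, b \in bs -> [/\ (size b <= K)%N, {subset map snd b <= G}
      & forall j, conf (component (block_sum b) j) (component (Y - X) j)]) ->
    energy psi X <= 0 -> energy psi Y <= 0 -> energy phi Y < energy phi X ->
    (forall k t, `|Y k t - X k t| <= B)%N ->
  exists b a, [/\ (size b <= K)%N, {subset map snd b <= G}, (2 ^ a <= B)%N,
      energy psi (X + block_sum b *+ (2 ^ a)) <= 0
    & energy phi X - energy phi Y <= (2 * (l * size G).+1 ^ K)%:Z *
        (energy phi X - energy phi (X + block_sum b *+ (2 ^ a)))].
Proof.
move=> phi_cvx psi_cvx psi0 sum_bs bsP X0 Y0 YX XYB.
pose u := undup bs; pose lam b := count_mem b bs.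
have sum_u : \sum_(b <- u) block_sum b *+ lam b = Y - X.
  exact: etrans (sum_undup_count _ _) sum_bs.
have conf_u b j : b \in u -> conf (component (block_sum b *+ lam b) j) (component (Y - X) j).
  rewrite mem_undup => bbs.
  have -> : component (block_sum b *+ lam b) j
      = \sum_(b' <- [seq b' <- bs | pred1 b b']) component (block_sum b') j.
    rewrite big_filter (eq_bigr (fun=> component (block_sum b) j)) => [|b' /eqP-> //].
    by rewrite big_const_seq iter_addr_0 componentMn -mulr_natl natz.
  apply: (@conf_sum _ _ [seq b' <- bs | predC (pred1 b) b']) => [b'|].
    by rewrite mem_cat !mem_filter => /orP[]/andP[_ /bsP[]].
  rewrite -component_sum -sum_bs; congr component.
  by apply: perm_big; rewrite perm_filterC.
(* superadditivity, summed over all components *)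
have gain : \sum_(b <- u) (energy phi (X + block_sum b *+ lam b) - energy phi X)
    <= energy phi Y - energy phi X.
  under eq_bigr do rewrite -sumrB.
  rewrite exchange_big -sumrB; apply: ler_sum => j _ /=.
  under eq_bigr do rewrite componentD.
  have -> : component Y j = component X j + component (Y - X) j by rewrite -componentD addrC subrK.
  apply: convex_superadd => // [b|]; first exact: conf_u.
  by rewrite -component_sum sum_u.
pose m := ((l * size G).+1 ^ K)%N.
have um : (size u <= m)%N.
  rewrite /m; have <- : size [seq (k, g) | k <- enum 'I_l, g <- G] = (l * size G)%N.
    by rewrite size_allpairs size_enum_ord.
  apply: uniq_words_size => [|b]; first exact: undup_uniq.
  rewrite mem_undup => /bsP[bK bG _]; split=> // -[k g] kgb.
  apply/allpairsP; exists (k, g); rewrite mem_enum; split=> //.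
  exact/bG/(map_f snd kgb).
have [|b bu gain_b] := exists_below_average um (le_lt_trans gain _).
  by rewrite subr_lt0.
move: (bu); rewrite mem_undup => bbs; have [bK bG _] := bsP b bbs.
have lam_gt0 : (0 < lam b)%N by rewrite -has_count has_pred1.
have /andP[lam_ge lam_lt] := trunc_log_bounds (isT : (1 < 2)%N) lam_gt0.
set a := trunc_log 2 (lam b) in lam_ge lam_lt.
have dec : energy phi (X + block_sum b *+ lam b) - energy phi X < 0.
  rewrite -(pmulr_rlt0 _ (_ : 0 < m%:Z)); last by rewrite ltz_nat expn_gt0.
  by apply: le_lt_trans gain_b (le_lt_trans gain _); rewrite subr_lt0.
(* each copy of the block moves some entry of [X] by at least one towards [Y] *)
have lamB : (lam b <= B)%N.
  have [/existsP[k /existsP[t kt]]|none] := boolP [exists k, exists t, block_sum b k t != 0].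
    apply: leq_trans (XYB k t); have := conf_u b (inr (k, t)) bu.
    rewrite componentMn /= !ffunE; move: (block_sum b k t : int) kt (Y k t - X k t : int) => v v0 w.
    rewrite /conf => vw; have : (lam b <= lam b * `|v|)%N by rewrite leq_pmulr //; lia.
    by move: (lam b) vw => n; nia.
  have b0 : block_sum b = 0.
    apply/ffunP => k; apply/ffunP => t; apply/eqP; rewrite !ffunE.
    apply: contraNT none => kt; apply/existsP; exists k; apply/existsP; exists t.
    by [].
  by move: dec; rewrite b0 mul0rn addr0 subrr ltxx.
exists b, a; split=> //.
- exact: leq_trans lam_ge lamB.
- apply: (energy_between psi_cvx psi0 lam_ge X0).
  apply: (energy_conf_le psi_cvx psi0 (fun j => conf_u b j bu) X0).
  by rewrite addrC subrK.
have := energy_scale X (block_sum b) phi_cvx lam_ge.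
move: gain gain_b dec; rewrite -/m.
move: (\sum_(b <- u) _ : int) => S.
move: (energy phi X) (energy phi Y) (energy phi (X + block_sum b *+ lam b)).
move: (energy phi (X + block_sum b *+ 2 ^ a)) => Ea E0 EY El.
rewrite expnS in lam_lt.
move: (2 ^ a)%N (lam b) lam_ge lam_lt lam_gt0 m {um} => p q pq qp q_gt0 m.
move=> S1 S2 dec scale.
have half : 2 * (Ea - E0) <= El - E0.
  have qz : 0 < q%:Z by [].
  by rewrite -(ler_pM2l qz); nia.
by nia.
Qed.

End AugmentingBlock.

(** * Evaluation with unbounded integers *)

Lemma bitlen_le z n : (bitlen z <= n.+1)%N = (`|z| < 2 ^ n)%N.
Proof.
rewrite /bitlen ltnS; apply/idP/idP => [le_n|]; last exact: up_log_min.
by apply: leq_trans (up_logP _ (isT : 1 < 2)%N) _; rewrite leq_exp2l.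
Qed.

Lemma bitlenS z : bitlen z = (bitlen z).-1.+1.
Proof. by []. Qed.

Lemma bitlen_add z1 z2 n : (bitlen z1 <= n)%N -> (bitlen z2 <= n)%N ->
  (bitlen (z1 + z2) <= n.+1)%N.
Proof.
case: n => [|n]; first by rewrite bitlenS.
rewrite !bitlen_le expnS; move: (2 ^ n)%N => p; lia.
Qed.

Lemma bitlenN z : bitlen (- z) = bitlen z.
Proof. by rewrite /bitlen abszN. Qed.

Lemma bitlen_sub z1 z2 n : (bitlen z1 <= n)%N -> (bitlen z2 <= n)%N ->
  (bitlen (z1 - z2) <= n.+1)%N.
Proof. by move=> n1 n2; apply: bitlen_add; rewrite ?bitlenN. Qed.

Section Run.
Variables (G : digraph) (I : instance G) (b : nat).
Notation E := (edge G).
Implicit Types (env : seq (value E)) (t : term E) (r : value E) (c : nat).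

(** [eval] without the bound on the length of sums and differences.  The bound [b]
on the oracle answers remains: it cannot be recovered from the number of
steps. *)
Inductive run : seq (value E) -> term E -> value E -> nat -> Prop :=
| run_var env n r : onth env n = Some r -> run env (Var n) r 1%N
| run_fun env t : run env (Fun t) (VClos env t) 1%N
| run_app env t1 t2 env' t r2 r c1 c2 c3 :
    run env t1 (VClos env' t) c1 -> run env t2 r2 c2 ->
    run (r2 :: VClos env' t :: env') t r c3 ->
    run env (App t1 t2) r (c1 + c2 + c3).+1%N
| run_lit env z : run env (Lit z) (VInt z) 1%N
| run_add env t1 t2 z1 z2 c1 c2 :
    run env t1 (VInt z1) c1 -> run env t2 (VInt z2) c2 ->
    run env (TAdd t1 t2) (VInt (z1 + z2)) (c1 + c2).+1%N
| run_sub env t1 t2 z1 z2 c1 c2 :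
    run env t1 (VInt z1) c1 -> run env t2 (VInt z2) c2 ->
    run env (TSub t1 t2) (VInt (z1 - z2)) (c1 + c2).+1%N
| run_ifle env t1 t2 t3 t4 z1 z2 r c1 c2 c3 :
    run env t1 (VInt z1) c1 -> run env t2 (VInt z2) c2 ->
    run env (if z1 <= z2 then t3 else t4) r c3 ->
    run env (IfLe t1 t2 t3 t4) r (c1 + c2 + c3).+1%N
| run_nil env : run env TNil VNil 1%N
| run_cons env t1 t2 r1 r2 c1 c2 :
    run env t1 r1 c1 -> run env t2 r2 c2 ->
    run env (TCons t1 t2) (VCons r1 r2) (c1 + c2).+1%N
| run_case_nil env t1 t2 t3 r c1 c2 :
    run env t1 VNil c1 -> run env t2 r c2 ->
    run env (Case t1 t2 t3) r (c1 + c2).+1%N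
| run_case_cons env t1 t2 t3 r1 r2 r c1 c3 :
    run env t1 (VCons r1 r2) c1 -> run (r1 :: r2 :: env) t3 r c3 ->
    run env (Case t1 t2 t3) r (c1 + c3).+1%N
| run_askf env e t z c :
    run env t (VInt z) c -> (bitlen (fcost I e z) <= b)%N ->
    run env (AskF e t) (VInt (fcost I e z)) c.+1
| run_askg env e t1 t2 (k : 'I_(ncom I)) z c1 c2 :
    run env t1 (VInt (val k)%:Z) c1 -> run env t2 (VInt z) c2 ->
    (bitlen (gcost I k e z) <= b)%N ->
    run env (AskG e t1 t2) (VInt (gcost I k e z)) (c1 + c2).+1%N.

Fixpoint term_bits t : nat :=
  match t with
  | Var _ | TNil => 0
  | Fun t | AskF _ t => term_bits t
  | Lit z => bitlen z
  | App t1 t2 | TAdd t1 t2 | TSub t1 t2 | TCons t1 t2 | AskG _ t1 t2 =>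
      maxn (term_bits t1) (term_bits t2)
  | IfLe t1 t2 t3 t4 =>
      maxn (maxn (term_bits t1) (term_bits t2)) (maxn (term_bits t3) (term_bits t4))
  | Case t1 t2 t3 => maxn (term_bits t1) (maxn (term_bits t2) (term_bits t3))
  end.

(** Closures count with their environment and with the literals of their code, as
both can still be read later. *)
Fixpoint value_fits (m : nat) r : bool :=
  match r with
  | VInt z => (bitlen z <= m)%N
  | VNil => true
  | VCons r1 r2 => value_fits m r1 && value_fits m r2
  | VClos env t => all (value_fits m) env && (term_bits t <= m)%N
  end.

Lemma value_fits_mono m n : (m <= n)%N -> forall r, value_fits m r -> value_fits n r.
Proof.
move=> mn; fix IH 1 => -[z||r1 r2|env t] /=.
- by move=> /leq_trans; apply.
- by [].
- by case/andP=> /IH-> /IH->.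
case/andP=> fits_env t_m; rewrite (leq_trans t_m mn) andbT.
by elim: env fits_env => //= r env IHenv /andP[/IH-> /IHenv->].
Qed.

Lemma env_fits_mono m n env : (m <= n)%N ->
  all (value_fits m) env -> all (value_fits n) env.
Proof. by move=> mn; apply: sub_all; exact: value_fits_mono. Qed.

Lemma onth_all (A : Type) (p : pred A) s n x : onth s n = Some x -> all p s -> p x.
Proof.
elim: s n => [|a s IH] [|n] //=; first by case=> -> /andP[].
by move=> /IH p_x /andP[_ /p_x].
Qed.

(** The invariant is that all integers at hand have at most [m] bits plus the number
of steps made so far. *)
Lemma run_eval env t r c : run env t r c ->
  forall m, (b <= m)%N -> all (value_fits m) env -> (term_bits t <= m)%N ->
    value_fits (m + c) r /\ forall w, (m + c <= w)%N -> eval I w env t r c.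
Proof.
elim=> {env t r c}.
- move=> env n r env_n m bm env_m _; split=> [|w _]; last exact: eval_var.
  by apply: value_fits_mono (onth_all env_n env_m); exact: leq_addr.
- move=> env t m bm env_m t_m; split=> [|w _]; last exact: eval_fun.
  by apply: (@value_fits_mono m); rewrite ?leq_addr //= env_m.
- move=> env t1 t2 env' t r2 r c1 c2 c3 _ IH1 _ IH2 _ IH3 m bm env_m.
  rewrite /= geq_max => /andP[] /(IH1 m bm env_m)[/andP[fit_env' fit_t] ev1].
  move=> /(IH2 m bm env_m)[fit2 ev2].
  have [||/=|fit3 ev3] := IH3 (m + c1 + c2)%N.
  + by rewrite -addnA (leq_trans bm) ?leq_addr.
  + rewrite /= (value_fits_mono _ fit2) ?(env_fits_mono _ fit_env') //; lia.
  + by apply: leq_trans fit_t _; lia.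
  split=> [|w le_w]; first by apply: value_fits_mono fit3; lia.
  by apply: eval_app (ev1 w _) (ev2 w _) (ev3 w _); lia.
- move=> env z m bm env_m fit; split=> [|w _]; last exact: eval_lit.
  by apply: (@value_fits_mono m); rewrite ?leq_addr.
- move=> env t1 t2 z1 z2 c1 c2 _ IH1 _ IH2 m bm env_m.
  rewrite /= geq_max => /andP[] /(IH1 m bm env_m)[fit1 ev1] /(IH2 m bm env_m)[fit2 ev2].
  have fit : (bitlen (z1 + z2) <= m + (c1 + c2).+1)%N.
    by rewrite addnS; apply: bitlen_add; [apply: leq_trans fit1 _|apply: leq_trans fit2 _]; lia.
  split=> // w le_w; apply: eval_add (ev1 w _) (ev2 w _) _; lia.
- move=> env t1 t2 z1 z2 c1 c2 _ IH1 _ IH2 m bm env_m.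
  rewrite /= geq_max => /andP[] /(IH1 m bm env_m)[fit1 ev1] /(IH2 m bm env_m)[fit2 ev2].
  have fit : (bitlen (z1 - z2) <= m + (c1 + c2).+1)%N.
    by rewrite addnS; apply: bitlen_sub; [apply: leq_trans fit1 _|apply: leq_trans fit2 _]; lia.
  split=> // w le_w; apply: eval_sub (ev1 w _) (ev2 w _) _; lia.
- move=> env t1 t2 t3 t4 z1 z2 r c1 c2 c3 _ IH1 _ IH2 _ IH3 m bm env_m.
  rewrite /= !geq_max -!andbA => /and4P[/(IH1 m bm env_m)[_ ev1]].
  move=> /(IH2 m bm env_m)[_ ev2] fit3 fit4.
  have [|fit ev3] := IH3 m bm env_m; first by case: ifP.
  split=> [|w le_w]; first by apply: value_fits_mono fit; lia.
  by apply: eval_ifle (ev1 w _) (ev2 w _) (ev3 w _); lia.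
- by move=> env m _ _ _; split=> // w _; exact: eval_nil.
- move=> env t1 t2 r1 r2 c1 c2 _ IH1 _ IH2 m bm env_m.
  rewrite /= geq_max => /andP[] /(IH1 m bm env_m)[fit1 ev1] /(IH2 m bm env_m)[fit2 ev2].
  split=> [|w le_w]; last by apply: eval_cons (ev1 w _) (ev2 w _); lia.
  by rewrite /= (value_fits_mono _ fit1) ?(value_fits_mono _ fit2) //; lia.
- move=> env t1 t2 t3 r c1 c2 _ IH1 _ IH2 m bm env_m.
  rewrite /= !geq_max => /and3P[/(IH1 m bm env_m)[_ ev1] /(IH2 m bm env_m)[fit2 ev2] _].
  split=> [|w le_w]; first by apply: value_fits_mono fit2; lia.
  by apply: eval_case_nil (ev1 w _) (ev2 w _); lia.
- move=> env t1 t2 t3 r1 r2 r c1 c3 _ IH1 _ IH3 m bm env_m.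
  rewrite /= !geq_max => /and3P[/(IH1 m bm env_m)[/andP[fit1 fit2] ev1] _ fit_t3].
  have [||/=|fit3 ev3] := IH3 (m + c1)%N.
  + by rewrite (leq_trans bm) ?leq_addr.
  + by apply/and3P; split=> //; apply: env_fits_mono env_m; rewrite leq_addr.
  + by apply: leq_trans fit_t3 _; lia.
  split=> [|w le_w]; first by apply: value_fits_mono fit3; lia.
  by apply: eval_case_cons (ev1 w _) (ev3 w _); lia.
- move=> env e t z c _ IH fit m bm env_m /(IH m bm env_m)[_ ev].
  have fit' : (bitlen (fcost I e z) <= m + c.+1)%N by lia.
  split=> // w le_w; apply: eval_askf (ev w _) _; lia.
- move=> env e t1 t2 k z c1 c2 _ IH1 _ IH2 fit m bm env_m.
  rewrite /= geq_max => /andP[] /(IH1 m bm env_m)[_ ev1] /(IH2 m bm env_m)[_ ev2].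
  have fit' : (bitlen (gcost I k e z) <= m + (c1 + c2).+1)%N by lia.
  split=> // w le_w; apply: eval_askg (ev1 w _) (ev2 w _) _; lia.
Qed.

End Run.

(** * The search program *)

(** Functions are curried.  Inside [Fun (Fun t)] the environment starts with the
second argument, the inner closure, the first argument and the outer closure.
A recursive call goes to the closure that still has the arguments that do not
change.  In the second branch of a [Case], all indices are larger by two. *)

Section Terms.
Variable E : Type.
Implicit Types (t : term E).

Definition tLet t1 t2 := App (Fun t2) t1.
Definition tApp2 t t1 t2 := App (App t t1) t2.
Definition tApp3 t t1 t2 t3 := App (tApp2 t t1 t2) t3.
Definition tApp4 t t1 t2 t3 t4 := App (tApp3 t t1 t2 t3) t4.

(** [a |-> b |-> a + b] for rows [a] and [b] *)
Definition addrow_body : term E :=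
  Fun (Case (Var 2) TNil (Case (Var 2) TNil
    (TCons (TAdd (Var 2) (Var 0)) (tApp2 (Var 7) (Var 3) (Var 1))))).
Definition tAddrow := Fun addrow_body.

(** [M |-> [seq m + m | m <- M]] *)
Definition double_body : term E :=
  Case (Var 0) TNil
    (TCons (tApp2 tAddrow (Var 0) (Var 0)) (App (Var 3) (Var 1))).
Definition tDouble := Fun double_body.

(** [B |-> p |-> M |-> [:: M; 2 M; 4 M; ...]], as long as [p, 2 p, 4 p, ...] stay
    below [B] *)
Definition ladder_body : term E :=
  Fun (IfLe (Var 2) (Var 4)
    (TCons (Var 0) (tApp2 (Var 3) (TAdd (Var 2) (Var 2)) (App tDouble (Var 0))))
    TNil).
Definition tLadder := Fun (Fun ladder_body).

(** [r |-> rs |-> acc |-> M |-> [seq (r + m) :: rs | m <- M] ++ acc] *)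
Definition addall_body : term E :=
  Case (Var 0) (Var 2)
    (TCons (TCons (tApp2 tAddrow (Var 8) (Var 0)) (Var 6)) (App (Var 3) (Var 1))).
Definition tAddall := Fun (Fun (Fun (Fun addall_body))).

(** [r |-> L |-> [seq r :: s | s <- L]] *)
Definition consall_body : term E :=
  Case (Var 0) TNil (TCons (TCons (Var 4) (Var 0)) (App (Var 3) (Var 1))).
Definition tConsall := Fun (Fun consall_body).

(** [M |-> x |->] the states obtained from [x] by adding an element of [M] to at
    most one row *)
Definition nbr_body : term E :=
  Case (Var 0) (TCons TNil TNil)
    (tApp4 tAddall (Var 0) (Var 1)
      (tApp2 tConsall (Var 0) (App (Var 3) (Var 1))) (Var 4)).
Definition tNbr := Fun (Fun nbr_body).

(** [b |-> a |-> a ++ b] *)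
Definition append_body : term E :=
  Case (Var 0) (Var 2) (TCons (Var 0) (App (Var 3) (Var 1))).
Definition tAppend := Fun (Fun append_body).

Definition nbrs_body : term E :=
  Case (Var 0) TNil
    (tApp2 tAppend (App (Var 3) (Var 1)) (tApp2 tNbr (Var 4) (Var 0))).
Definition tNbrs := Fun (Fun nbrs_body).

(** Blocks of at most [K] pairs are reached in [K] rounds, as the unchanged state is
among its own neighbours. *)
Definition tCands (K : nat) (tM tx : term E) : term E :=
  iter K (tApp2 tNbrs tM) (TCons tx TNil).

(** [kappa |-> b0 |-> L |->] a cheapest pair of a cost and a state among [b0] and
    the states in [L] to which [kappa] assigns a cost *)
Definition scan_body : term E :=
  Case (Var 0) (Var 2)
    (Case (App (Var 3) (Var 1)) TNil
      (Case (App (Var 8) (Var 2)) (TCons (Var 0) (Var 1))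
        (IfLe (Var 2) (Var 0) (TCons (Var 2) (Var 3)) (TCons (Var 0) (Var 4))))).
Definition tScan := Fun (Fun (Fun scan_body)).

(** [kappa |-> x |-> b0 |-> MM |->] a cheapest pair among [b0] and the candidates
    around [x] for the lists of rows in [MM] *)
Definition search_body (K : nat) : term E :=
  Case (Var 0) (Var 2)
    (tApp3 tScan (Var 8) (App (Var 3) (Var 1)) (tCands K (Var 0) (Var 6))).
Definition tSearch K := Fun (Fun (Fun (Fun (search_body K)))).

(** [kappa |-> MM |-> bx |->] the last pair of the descent from [bx], which goes on
    as long as the cost decreases *)
Definition loop_body (K : nat) : term E :=
  Case (Var 0) TNil
    (Case (tApp4 (tSearch K) (Var 6) (Var 1) (Var 2) (Var 4)) TNil
      (IfLe (Var 2) (Var 0) (Var 4) (App (Var 5) (TCons (Var 0) (Var 1))))).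
Definition tLoop K := Fun (Fun (Fun (loop_body K))).

End Terms.

Section Runs.
Variables (G : digraph) (I : instance G) (b : nat).
Notation E := (edge G).
Implicit Types (env : seq (value E)) (t : term E) (r : value E) (c n : nat).

(** Only an upper bound on the number of steps is kept, so that bounds can be
weakened within a derivation. *)
Definition runs env t r n := exists2 c, run I b env t r c & (c <= n)%N.

Lemma runs_le env t r n n' : runs env t r n -> (n <= n')%N -> runs env t r n'.
Proof. by move=> [c ev cn] nn'; exists c; rewrite ?(leq_trans cn). Qed.

Lemma runs_var env n r : onth env n = Some r -> runs env (Var n) r 1.
Proof. by move=> env_n; exists 1%N => //; exact: run_var. Qed.

Lemma runs_fun env t : runs env (Fun t) (VClos env t) 1.
Proof. by exists 1%N => //; exact: run_fun. Qed.

Lemma runs_app env t1 t2 env' t r2 r n1 n2 n3 :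
  runs env t1 (VClos env' t) n1 -> runs env t2 r2 n2 ->
  runs (r2 :: VClos env' t :: env') t r n3 ->
  runs env (App t1 t2) r (n1 + n2 + n3).+1.
Proof.
move=> [c1 ev1 le1] [c2 ev2 le2] [c3 ev3 le3].
by exists (c1 + c2 + c3).+1; [exact: run_app ev1 ev2 ev3 | lia].
Qed.

Lemma runs_lit env z : runs env (Lit z) (VInt z) 1.
Proof. by exists 1%N => //; exact: run_lit. Qed.

Lemma runs_add env t1 t2 z1 z2 n1 n2 :
  runs env t1 (VInt z1) n1 -> runs env t2 (VInt z2) n2 ->
  runs env (TAdd t1 t2) (VInt (z1 + z2)) (n1 + n2).+1.
Proof.
move=> [c1 ev1 le1] [c2 ev2 le2].
by exists (c1 + c2).+1; [exact: run_add ev1 ev2 | lia].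
Qed.

Lemma runs_sub env t1 t2 z1 z2 n1 n2 :
  runs env t1 (VInt z1) n1 -> runs env t2 (VInt z2) n2 ->
  runs env (TSub t1 t2) (VInt (z1 - z2)) (n1 + n2).+1.
Proof.
move=> [c1 ev1 le1] [c2 ev2 le2].
by exists (c1 + c2).+1; [exact: run_sub ev1 ev2 | lia].
Qed.

Lemma runs_ifle env t1 t2 t3 t4 z1 z2 r n1 n2 n3 :
  runs env t1 (VInt z1) n1 -> runs env t2 (VInt z2) n2 ->
  runs env (if z1 <= z2 then t3 else t4) r n3 ->
  runs env (IfLe t1 t2 t3 t4) r (n1 + n2 + n3).+1.
Proof.
move=> [c1 ev1 le1] [c2 ev2 le2] [c3 ev3 le3].
by exists (c1 + c2 + c3).+1; [exact: run_ifle ev1 ev2 ev3 | lia].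
Qed.

Lemma runs_nil env : runs env TNil VNil 1.
Proof. by exists 1%N => //; exact: run_nil. Qed.

Lemma runs_cons env t1 t2 r1 r2 n1 n2 :
  runs env t1 r1 n1 -> runs env t2 r2 n2 ->
  runs env (TCons t1 t2) (VCons r1 r2) (n1 + n2).+1.
Proof.
move=> [c1 ev1 le1] [c2 ev2 le2].
by exists (c1 + c2).+1; [exact: run_cons ev1 ev2 | lia].
Qed.

Lemma runs_case_nil env t1 t2 t3 r n1 n2 :
  runs env t1 VNil n1 -> runs env t2 r n2 ->
  runs env (Case t1 t2 t3) r (n1 + n2).+1.
Proof.
move=> [c1 ev1 le1] [c2 ev2 le2].
by exists (c1 + c2).+1; [exact: run_case_nil ev1 ev2 | lia].
Qed.

Lemma runs_case_cons env t1 t2 t3 r1 r2 r n1 n3 :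
  runs env t1 (VCons r1 r2) n1 -> runs (r1 :: r2 :: env) t3 r n3 ->
  runs env (Case t1 t2 t3) r (n1 + n3).+1.
Proof.
move=> [c1 ev1 le1] [c3 ev3 le3].
by exists (c1 + c3).+1; [exact: run_case_cons ev1 ev3 | lia].
Qed.

Lemma runs_askf env e t z n :
  runs env t (VInt z) n -> (bitlen (fcost I e z) <= b)%N ->
  runs env (AskF e t) (VInt (fcost I e z)) n.+1.
Proof. by move=> [c ev le_c] fit; exists c.+1 => //; exact: run_askf. Qed.

Lemma runs_askg env e t1 t2 (k : 'I_(ncom I)) z n1 n2 :
  runs env t1 (VInt (val k)%:Z) n1 -> runs env t2 (VInt z) n2 ->
  (bitlen (gcost I k e z) <= b)%N ->
  runs env (AskG e t1 t2) (VInt (gcost I k e z)) (n1 + n2).+1.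
Proof.
move=> [c1 ev1 le1] [c2 ev2 le2] fit.
by exists (c1 + c2).+1; [exact: run_askg ev1 ev2 fit | lia].
Qed.

End Runs.

Ltac rsimple :=
  first [ eapply runs_var; reflexivity | eapply runs_lit | eapply runs_nil
        | eapply runs_fun | eassumption
        | eapply runs_cons; [rsimple | rsimple]
        | eapply runs_add; [rsimple | rsimple]
        | eapply runs_sub; [rsimple | rsimple]
        ].

Section Specs.
Variables (G : digraph) (I : instance G) (b : nat).
Notation E := (edge G).
Implicit Types (env : seq (value E)) (r : value E) (c n : nat).
Notation runs := (runs I b).
Variables (T : finType) (ts : seq T).
Notation row := {ffun T -> int}.

Definition vints (s : seq int) : value E := vlist [seq VInt z | z <- s].
Definition vrow (g : row) : value E := vints [seq g t | t <- ts].
Definition vstate (x : seq row) : value E := vlist [seq vrow g | g <- x].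

(** As in the lemmas on the other recursive functions, the function is any term [tf]
that evaluates to its closure, for a first call as well as for a recursive
one. *)
Lemma runs_addints env0 env tf t1 t2 nf n1 n2 (A : Type) (s : seq A) (f g : A -> int) :
  runs env0 tf (VClos env (addrow_body E)) nf ->
  runs env0 t1 (vints (map f s)) n1 -> runs env0 t2 (vints (map g s)) n2 ->
  runs env0 (tApp2 tf t1 t2) (vints [seq f a + g a | a <- s])
    (nf + n1 + n2 + 20 * size s + 20).
Proof.
elim: s env0 env tf t1 t2 nf n1 n2 => [|a s IH] env0 env tf t1 t2 nf n1 n2 Hf H1 H2.
  eapply runs_le.
    eapply runs_app; [eapply runs_app; [exact: Hf|exact: H1|eapply runs_fun]|exact: H2|].
    eapply runs_case_nil; rsimple.
  rewrite /=; lia.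
eapply runs_le.
  eapply runs_app; [eapply runs_app; [exact: Hf|exact: H1|eapply runs_fun]|exact: H2|].
  eapply runs_case_cons; first rsimple.
  eapply runs_case_cons; first rsimple.
  eapply runs_cons; first rsimple.
  eapply IH; rsimple.
rewrite /=; lia.
Qed.


Notation N := (size ts).

Lemma runs_addrow env0 t1 t2 n1 n2 (g h : row) :
  runs env0 t1 (vrow g) n1 -> runs env0 t2 (vrow h) n2 ->
  runs env0 (tApp2 (tAddrow E) t1 t2) (vrow (g + h)) (n1 + n2 + 20 * N + 21).
Proof.
move=> H1 H2.
have -> : vrow (g + h) = vints [seq g a + h a | a <- ts].
  by rewrite /vrow; congr vints; apply: eq_map => a; rewrite ffunE.
eapply runs_le; first by eapply (runs_addints (s := ts)); [eapply runs_fun|exact: H1|exact: H2].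
lia.
Qed.

Lemma runs_double env0 env tf t nf n (M : seq row) :
  runs env0 tf (VClos env (double_body E)) nf -> runs env0 t (vstate M) n ->
  runs env0 (App tf t) (vstate [seq g *+ 2 | g <- M])
    (nf + n + size M * (20 * N + 40) + 10).
Proof.
elim: M env0 env tf t nf n => [|g M IH] env0 env tf t nf n Hf Ht.
  eapply runs_le; first by eapply runs_app; [exact: Hf|exact: Ht|eapply runs_case_nil; rsimple].
  rewrite /=; lia.
eapply runs_le.
  eapply runs_app; [exact: Hf|exact: Ht|].
  eapply runs_case_cons; first rsimple.
  eapply runs_cons; first (eapply runs_addrow; rsimple).
  eapply IH; rsimple.
rewrite /=; lia.
Qed.

Definition vstates (L : seq (seq row)) : value E := vlist [seq vstate x | x <- L].

Definition ladder (M : seq row) (a n : nat) : seq (seq row) :=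
  [seq [seq g *+ 2 ^ i | g <- M] | i <- iota a n].

Lemma runs_ladder env0 env v tf t1 t2 nf n1 n2 (M : seq row) (B a n : nat) :
    (forall i, (2 ^ i <= B)%N = (i < a + n)%N) ->
    runs env0 tf (VClos (VInt B :: v :: env) (ladder_body E)) nf ->
    runs env0 t1 (VInt (2 ^ a)%N) n1 ->
    runs env0 t2 (vstate [seq g *+ 2 ^ a | g <- M]) n2 ->
  runs env0 (tApp2 tf t1 t2) (vstates (ladder M a n))
    (nf + n1 + n2 + n * (size M * (20 * N + 40) + 50) + 10).
Proof.
elim: n a env0 env v tf t1 t2 nf n1 n2 => [|n IH] a env0 env v tf t1 t2 nf n1 n2 HB Hf H1 H2.
  eapply runs_le.
    eapply runs_app; [eapply runs_app; [exact: Hf|exact: H1|eapply runs_fun]|exact: H2|].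
    eapply runs_ifle; [rsimple|rsimple|].
    by rewrite lez_nat HB addn0 ltnn; rsimple.
  rewrite /=; lia.
eapply runs_le.
  eapply runs_app; [eapply runs_app; [exact: Hf|exact: H1|eapply runs_fun]|exact: H2|].
  eapply runs_ifle; [rsimple|rsimple|].
  rewrite lez_nat HB addnS leq_addr /ladder /=.
  eapply runs_cons; first rsimple.
  apply: (IH a.+1); first by move=> i; rewrite HB addnS.
  - rsimple.
  - by rewrite expnS mul2n -addnn PoszD; rsimple.
  - have -> : [seq g *+ 2 ^ a.+1 | g <- M] = [seq g *+ 2 | g <- [seq g *+ 2 ^ a | g <- M]].
      by rewrite -map_comp; apply: eq_map => g /=; rewrite -mulrnA expnSr.
    by eapply runs_double; rsimple.
rewrite size_map /=; lia.
Qed.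

Lemma runs_addall env0 env v1 v2 v3 tf t nf n (acc : seq (seq row)) (rs : seq row)
    (g : row) (M : seq row) :
    runs env0 tf (VClos (vstates acc :: v1 :: vstate rs :: v2 :: vrow g :: v3 :: env)
      (addall_body E)) nf ->
    runs env0 t (vstate M) n ->
  runs env0 (App tf t) (vstates ([seq (g + m) :: rs | m <- M] ++ acc))
    (nf + n + size M * (20 * N + 40) + 10).
Proof.
elim: M env0 env v1 v2 v3 tf t nf n => [|m M IH] env0 env v1 v2 v3 tf t nf n Hf Ht.
  eapply runs_le; first by eapply runs_app; [exact: Hf|exact: Ht|eapply runs_case_nil; rsimple].
  rewrite /=; lia.
eapply runs_le.
  eapply runs_app; [exact: Hf|exact: Ht|].
  eapply runs_case_cons; first rsimple.
  eapply runs_cons; first (eapply runs_cons; [eapply runs_addrow; rsimple|rsimple]).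
  eapply IH; rsimple.
rewrite /=; lia.
Qed.

Lemma runs_consall env0 env v tf t nf n (g : row) (L : seq (seq row)) :
    runs env0 tf (VClos (vrow g :: v :: env) (consall_body E)) nf ->
    runs env0 t (vstates L) n ->
  runs env0 (App tf t) (vstates [seq g :: s | s <- L]) (nf + n + 20 * size L + 10).
Proof.
elim: L env0 env v tf t nf n => [|s L IH] env0 env v tf t nf n Hf Ht.
  eapply runs_le; first by eapply runs_app; [exact: Hf|exact: Ht|eapply runs_case_nil; rsimple].
  rewrite /=; lia.
eapply runs_le.
  eapply runs_app; [exact: Hf|exact: Ht|].
  eapply runs_case_cons; first rsimple.
  eapply runs_cons; first rsimple.
  eapply IH; rsimple.
rewrite /=; lia.
Qed.

Fixpoint nbr (M x : seq row) : seq (seq row) :=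
  if x is g :: rs then [seq (g + m) :: rs | m <- M] ++ [seq g :: s | s <- nbr M rs]
  else [:: [::]].

Lemma size_nbr M x : size (nbr M x) = (size x * size M).+1.
Proof. by elim: x => //= g x IH; rewrite size_cat !size_map IH mulSn addnS. Qed.

Lemma nbr_size M x s : s \in nbr M x -> size s = size x.
Proof.
elim: x s => [|g x IH] s /=; first by rewrite inE => /eqP->.
by rewrite mem_cat => /orP[/mapP[m _ ->]|/mapP[s' /IH s'x ->]] //=; rewrite s'x.
Qed.

Definition nbr_cost (l m : nat) := (l * (m * (20 * N + 60) + l * m * 20 + 100) + 10)%N.

Lemma runs_nbr env0 env v tf t nf n (M x : seq row) :
    runs env0 tf (VClos (vstate M :: v :: env) (nbr_body E)) nf ->
    runs env0 t (vstate x) n ->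
  runs env0 (App tf t) (vstates (nbr M x)) (nf + n + nbr_cost (size x) (size M)).
Proof.
elim: x env0 env v tf t nf n => [|g x IH] env0 env v tf t nf n Hf Ht.
  eapply runs_le; first by eapply runs_app; [exact: Hf|exact: Ht|eapply runs_case_nil; rsimple].
  rewrite /nbr_cost /=; lia.
eapply runs_le.
  eapply runs_app; [exact: Hf|exact: Ht|].
  eapply runs_case_cons; first rsimple.
  eapply runs_addall; last rsimple.
  eapply runs_app; [|eapply runs_consall|eapply runs_fun].
  - eapply runs_app; [|rsimple|eapply runs_fun].
    by eapply runs_app; [eapply runs_fun|rsimple|eapply runs_fun].
  - by eapply runs_app; [eapply runs_fun|rsimple|eapply runs_fun].
  - by eapply IH; rsimple.
rewrite size_nbr /nbr_cost /=; lia.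
Qed.

Lemma runs_append env0 env v tf t nf n (L1 L2 : seq (seq row)) :
    runs env0 tf (VClos (vstates L2 :: v :: env) (append_body E)) nf ->
    runs env0 t (vstates L1) n ->
  runs env0 (App tf t) (vstates (L1 ++ L2)) (nf + n + 20 * size L1 + 10).
Proof.
elim: L1 env0 env v tf t nf n => [|s L IH] env0 env v tf t nf n Hf Ht.
  eapply runs_le; first by eapply runs_app; [exact: Hf|exact: Ht|eapply runs_case_nil; rsimple].
  rewrite /=; lia.
eapply runs_le.
  eapply runs_app; [exact: Hf|exact: Ht|].
  eapply runs_case_cons; first rsimple.
  eapply runs_cons; first rsimple.
  eapply IH; rsimple.
rewrite /=; lia.
Qed.

Definition nbrs (M : seq row) (L : seq (seq row)) : seq (seq row) :=
  flatten [seq nbr M x | x <- L].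

Lemma size_nbrs l M L : (forall x, x \in L -> size x = l) ->
  size (nbrs M L) = (size L * (l * size M).+1)%N.
Proof.
elim: L => //= x L IH Ll.
have Ll' y : y \in L -> size y = l by move=> yL; apply: Ll; rewrite inE yL orbT.
by rewrite size_cat size_nbr (IH Ll') Ll ?mem_head // mulSn.
Qed.

Definition nbrs_cost (l m : nat) := (nbr_cost l m + 20 * (l * m).+1 + 100)%N.

Lemma runs_nbrs l env0 env v tf t nf n (M : seq row) (L : seq (seq row)) :
    (forall x, x \in L -> size x = l) ->
    runs env0 tf (VClos (vstate M :: v :: env) (nbrs_body E)) nf ->
    runs env0 t (vstates L) n ->
  runs env0 (App tf t) (vstates (nbrs M L))
    (nf + n + size L * nbrs_cost l (size M) + 10).
Proof.
elim: L env0 env v tf t nf n => [|x L IH] env0 env v tf t nf n Ll Hf Ht.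
  eapply runs_le; first by eapply runs_app; [exact: Hf|exact: Ht|eapply runs_case_nil; rsimple].
  rewrite /=; lia.
eapply runs_le.
  eapply runs_app; [exact: Hf|exact: Ht|].
  eapply runs_case_cons; first rsimple.
  eapply runs_append.
  - eapply runs_app; [eapply runs_fun| |eapply runs_fun].
    eapply IH; [|rsimple|rsimple] => y yL.
    by apply: Ll; rewrite inE yL orbT.
  - eapply runs_nbr; last rsimple.
    by eapply runs_app; [eapply runs_fun|rsimple|eapply runs_fun].
rewrite size_nbr /nbrs_cost /= (Ll x) ?mem_head //; lia.
Qed.

Definition cands (K : nat) (M x : seq row) : seq (seq row) := iter K (nbrs M) [:: x].

Lemma nbrs_size l M L : (forall x, x \in L -> size x = l) ->
  forall x, x \in nbrs M L -> size x = l.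
Proof. by move=> Ll s /flatten_mapP[x xL /nbr_size->]; exact: Ll. Qed.

Lemma cands_size K M x s : s \in cands K M x -> size s = size x.
Proof.
elim: K s => [|K IH] s; first by rewrite inE => /eqP->.
by move/nbrs_size; apply; exact: IH.
Qed.

Lemma size_cands K M x : size (cands K M x) = ((size x * size M).+1 ^ K)%N.
Proof.
elim: K => //= K IH; rewrite (size_nbrs (l := size x)) ?IH ?expnSr //.
exact: cands_size.
Qed.

Definition cands_cost (l m K : nat) :=
  (K * ((l * m).+1 ^ K * nbrs_cost l m + 20) + 10)%N.

Lemma runs_cands K env tM tx nM nx (M x : seq row) :
    runs env tM (vstate M) nM -> runs env tx (vstate x) nx ->
  runs env (tCands K tM tx) (vstates (cands K M x))
    (K * nM + nx + cands_cost (size x) (size M) K).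
Proof.
move=> HM Hx; suff H k : (k <= K)%N -> runs env (tCands k tM tx) (vstates (cands k M x))
    (k * nM + nx + 3 + k * ((size x * size M).+1 ^ K * nbrs_cost (size x) (size M) + 20)).
  by eapply runs_le; [exact: H|rewrite /cands_cost; lia].
elim: k => [_|k IH kK].
  by eapply runs_le; [eapply runs_cons; [exact: Hx|rsimple]|lia].
eapply runs_le.
  eapply runs_nbrs; [exact: (@cands_size k)| |apply: IH; lia].
  by eapply runs_app; [eapply runs_fun|exact: HM|eapply runs_fun].
rewrite size_cands /=.
have : ((size x * size M).+1 ^ k <= (size x * size M).+1 ^ K)%N by rewrite leq_pexp2l // ltnW.
move: ((size x * size M).+1 ^ k)%N ((size x * size M).+1 ^ K)%N => p q.
move: (nbrs_cost _ _) => c pq; nia.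
Qed.

(** A cost function answers [VNil] for a state that has to be skipped. *)
Definition vopt (o : option int) : value E :=
  if o is Some c then VCons (VInt c) VNil else VNil.

Definition vpair (bx : int * seq row) : value E := VCons (VInt bx.1) (vstate bx.2).

Section Descent.
Variables (kappa : value E) (cost : seq row -> option int) (Ck : nat).
Variables (D : seq row -> Prop) (l K : nat) (MM : seq (seq row)) (Mmax : nat).

Definition scan (bx : int * seq row) (L : seq (seq row)) :=
  foldr (fun s bx => if cost s is Some c then
    if bx.1 <= c then bx else (c, s) else bx) bx L.

Definition search (bx : int * seq row) (x : seq row) (Ms : seq (seq row)) :=
  foldr (fun M bx => scan bx (cands K M x)) bx Ms.

(* [D] will say that the demands are met.  For other states, penalty 0 does not
   imply feasibility, and the oracle answers may be too long to be evaluated. *)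
Hypothesis kappaP : forall s, D s -> forall env tf t nf n,
  runs env tf kappa nf -> runs env t (vstate s) n ->
  runs env (App tf t) (vopt (cost s)) (nf + n + Ck).

Lemma runs_scan env0 env v1 v2 tf t nf n bx (L : seq (seq row)) :
    (forall s, s \in L -> D s) ->
    runs env0 tf (VClos (vpair bx :: v1 :: kappa :: v2 :: env) (scan_body E)) nf ->
    runs env0 t (vstates L) n ->
  runs env0 (App tf t) (vpair (scan bx L)) (nf + n + size L * (Ck + 50) + 10).
Proof.
elim: L env0 env v1 v2 tf t nf n => [|s L IH] env0 env v1 v2 tf t nf n LD Hf Ht.
  eapply runs_le; first by eapply runs_app; [exact: Hf|exact: Ht|eapply runs_case_nil; rsimple].
  rewrite /=; lia.
eapply runs_le.
  eapply runs_app; [exact: Hf|exact: Ht|].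
  eapply runs_case_cons; first rsimple.
  eapply runs_case_cons.
    eapply IH; [|rsimple|rsimple] => y yL.
    by apply: LD; rewrite inE yL orbT.
  instantiate (1 := (Ck + 20)%N).
  have Ds : D s by apply: LD; rewrite mem_head.
  rewrite /=; set bs := scan _ _.
  have := @kappaP s Ds.
  case: (cost s) => [c|] kP.
    eapply runs_le.
      eapply runs_case_cons; first (eapply kP; rsimple).
      eapply runs_ifle; [rsimple|rsimple|].
      by instantiate (1 := 3%N); case: ifP => _; (eapply runs_le; [rsimple|]).
    lia.
  eapply runs_le.
    eapply runs_case_nil; first (eapply kP; rsimple).
    rsimple.
  lia.
rewrite /=; lia.
Qed.

Definition search_cost :=
  (cands_cost l Mmax K + (l * Mmax).+1 ^ K * (Ck + 50) + K + 50)%N.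

Lemma runs_search env0 env v1 v2 v3 tf t nf n bx (x : seq row) (Ms : seq (seq row)) :
    size x = l -> (forall M, M \in Ms -> size M = Mmax) ->
    (forall M s, M \in Ms -> s \in cands K M x -> D s) ->
    runs env0 tf (VClos (vpair bx :: v1 :: vstate x :: v2 :: kappa :: v3 :: env)
      (search_body E K)) nf ->
    runs env0 t (vstates Ms) n ->
  runs env0 (App tf t) (vpair (search bx x Ms)) (nf + n + size Ms * search_cost + 10).
Proof.
move=> xl; elim: Ms env0 env v1 v2 v3 tf t nf n => [|M Ms IH] env0 env v1 v2 v3 tf t nf n MsM MsD Hf Ht.
  eapply runs_le; first by eapply runs_app; [exact: Hf|exact: Ht|eapply runs_case_nil; rsimple].
  rewrite /=; lia.
eapply runs_le.
  eapply runs_app; [exact: Hf|exact: Ht|].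
  eapply runs_case_cons; first rsimple.
  eapply runs_scan.
  - by move=> s; apply: MsD; rewrite mem_head.
  - eapply runs_app; [eapply runs_app; [eapply runs_fun|rsimple|eapply runs_fun]| |eapply runs_fun].
    eapply IH; [| |rsimple|rsimple].
    + by move=> M' M'Ms; apply: MsM; rewrite inE M'Ms orbT.
    + by move=> M' s M'Ms; apply: MsD; rewrite inE M'Ms orbT.
  - by eapply runs_cands; rsimple.
rewrite size_cands xl MsM ?mem_head // /search_cost /=; lia.
Qed.

Definition improve (bx : int * seq row) := search bx bx.2 MM.

(** [n] is the number of rounds allowed, [None] that they do not suffice. *)
Fixpoint descend (n : nat) (bx : int * seq row) : option (int * seq row) :=
  if n is n'.+1 then
    if bx.1 <= (improve bx).1 then Some bx else descend n' (improve bx)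
  else None.

Hypothesis D_size : forall s, D s -> size s = l.
Hypothesis MM_size : forall M, M \in MM -> size M = Mmax.
Hypothesis D_cands : forall x, D x -> forall M s, M \in MM -> s \in cands K M x -> D s.

Lemma scan_D bx L : D bx.2 -> (forall s, s \in L -> D s) -> D (scan bx L).2.
Proof.
move=> Dbx; elim: L => //= s L IH LD.
have {}IH : D (scan bx L).2 by apply: IH => y yL; apply: LD; rewrite inE yL orbT.
by case: (cost s) => // c; case: ifP => // _; apply: LD; rewrite mem_head.
Qed.

Lemma improve_D bx : D bx.2 -> D (improve bx).2.
Proof.
move=> Dbx; have := D_cands Dbx; rewrite /improve /search.
elim: MM => //= M Ms IH MsD; apply: scan_D.
  by apply: IH => M' s M'Ms; apply: MsD; rewrite inE M'Ms orbT.
by move=> s; apply: MsD; rewrite mem_head.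
Qed.

Definition loop_cost := (size MM * search_cost + 50)%N.

Lemma runs_loop i env0 env v1 v2 tf t nf n bx best :
    D bx.2 -> descend i bx = Some best ->
    runs env0 tf (VClos (vstates MM :: v1 :: kappa :: v2 :: env) (loop_body E K)) nf ->
    runs env0 t (vpair bx) n ->
  runs env0 (App tf t) (vpair best) (nf + n + i * loop_cost).
Proof.
elim: i env0 env v1 v2 tf t nf n bx => // i IH env0 env v1 v2 tf t nf n bx Dbx.
move=> desc Hf Ht.
eapply runs_le.
  eapply runs_app; [exact: Hf|exact: Ht|].
  eapply runs_case_cons; first rsimple.
  eapply runs_case_cons.
    eapply (runs_search (x := bx.2) (Ms := MM));
      [exact: D_size|exact: MM_size|exact: D_cands| |rsimple].
    eapply runs_app; [|rsimple|eapply runs_fun].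
    eapply runs_app; [|rsimple|eapply runs_fun].
    by eapply runs_app; [eapply runs_fun|rsimple|eapply runs_fun].
  eapply runs_ifle; [rsimple|rsimple|].
  instantiate (1 := (i * loop_cost + 5)%N).
  move: desc => /=; rewrite -/(improve bx); case: ifP => _ desc.
    by case: desc => <-; eapply runs_le; [rsimple|lia].
  eapply runs_le; first (eapply (IH _ _ _ _ _ _ _ _ (improve bx));
    [exact: improve_D|exact: desc|rsimple|rsimple]).
  lia.
rewrite /loop_cost /=; lia.
Qed.

End Descent.

End Specs.

Arguments vints {G} s.
Arguments vrow {G T} ts g.
Arguments vstate {G T} ts x.
Arguments vstates {G T} ts L.
Arguments vopt {G} o.
Arguments vpair {G T} ts bx.

(** * Convergence of the descent *)

Section States.
Variables (l : nat) (T : finType).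
Notation row := {ffun T -> int}.
Notation state := {ffun 'I_l -> row}.

Definition rows (X : state) : seq row := [seq X k | k <- enum 'I_l].
Definition of_rows (s : seq row) : state := [ffun k : 'I_l => nth 0 s k].

Lemma size_rows X : size (rows X) = l.
Proof. by rewrite size_map size_enum_ord. Qed.

Lemma nth_rows X (k : 'I_l) : nth 0 (rows X) k = X k.
Proof. by rewrite (nth_map k) ?size_enum_ord // nth_ord_enum. Qed.

Lemma rowsK : cancel rows of_rows.
Proof. by move=> X; apply/ffunP => k; rewrite ffunE nth_rows. Qed.

Lemma rows_single X k (m : row) :
  rows (X + single k m) = set_nth 0 (rows X) k (nth 0 (rows X) k + m).
Proof.
have sz : size (set_nth 0 (rows X) k (nth 0 (rows X) k + m)) = l.
  by rewrite size_set_nth size_rows; apply/maxn_idPr.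
apply: (@eq_from_nth _ 0) => [|i]; first by rewrite sz size_rows.
rewrite size_rows => il; rewrite nth_set_nth /= -[i]/(val (Ordinal il)).
rewrite !nth_rows !ffunE -val_eqE /=.
case: eqP => [ik|_]; last by rewrite addr0.
by have -> : Ordinal il = k by exact: val_inj.
Qed.

Lemma self_nbr (M x : seq row) : x \in nbr M x.
Proof. by elim: x => //= g x IH; rewrite mem_cat (map_f (cons g) IH) orbT. Qed.

Lemma nbrP (M x s : seq row) :
  s \in nbr M x <-> s = x \/ exists i m,
    [/\ (i < size x)%N, m \in M & s = set_nth 0 x i (nth 0 x i + m)].
Proof.
split=> [|[->|[i [m [ix mM ->]]]]]; last 2 first.
- exact: self_nbr.
- elim: x i ix => //= g x IH [_|i ix] /=.
    by rewrite mem_cat (map_f (fun m => (g + m) :: x)).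
  by rewrite mem_cat (map_f (cons g) (IH i ix)) orbT.
elim: x s => [|g x IH] s /=; first by rewrite inE => /eqP->; left.
rewrite mem_cat => /orP[/mapP[m mM ->]|/mapP[s' /IH[->|[i [m [ix mM ->]]]] ->]].
- by right; exists 0%N, m.
- by left.
- by right; exists i.+1, m.
Qed.

Lemma nbr_rows (M : seq row) X s :
  s \in nbr M (rows X) <-> s = rows X \/ exists k m,
    m \in M /\ s = rows (X + single k m).
Proof.
rewrite nbrP; split=> [[->|[i [m [il mM ->]]]]|[->|[k [m [mM ->]]]]]; [by left| |by left|].
  rewrite size_rows in il; right; exists (Ordinal il), m; split=> //.
  by rewrite rows_single.
by right; exists k, m; rewrite size_rows ltn_ord rows_single.
Qed.

Lemma singleMn (k : 'I_l) (g : row) n : single k g *+ n = single k (g *+ n).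
Proof.
by apply/ffunP => i; rewrite !(ffunMnE, ffunE); case: eqP => // _; rewrite mul0rn.
Qed.

Lemma cands_complete K (G : seq row) n X b :
    (size b <= K)%N -> {subset map snd b <= G} ->
  rows (X + block_sum b *+ n) \in cands K [seq g *+ n | g <- G] (rows X).
Proof.
elim: K b => [|K IH] [|[k g] b] //= bK bG.
- by rewrite /block_sum big_nil mul0rn addr0 inE.
- apply/flatten_mapP; exists (rows X); last first.
    by rewrite /block_sum big_nil mul0rn addr0 self_nbr.
  by have := IH [::] isT (fun _ => _); rewrite /block_sum big_nil mul0rn addr0; apply.
- apply/flatten_mapP; exists (rows (X + block_sum b *+ n)).
    by apply: IH => // h hb; apply: bG; rewrite inE hb orbT.
  apply/nbr_rows; right; exists k, (g *+ n); split.
    by apply/map_f/bG; rewrite mem_head.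
  by rewrite /block_sum big_cons mulrnDl singleMn -addrA; congr (rows (_ + _)); rewrite addrC.
Qed.

(** Used with [P] the set of states that meet the demands, which all the rows in [M]
preserve. *)
Lemma cands_sound K (M : seq row) (P : state -> Prop) X s :
    (forall Y k m, P Y -> m \in M -> P (Y + single k m)) ->
    P X -> s \in cands K M (rows X) ->
  exists2 Y, P Y & s = rows Y.
Proof.
move=> PM PX; elim: K s => [|K IH] s; first by rewrite inE => /eqP->; exists X.
move=> /flatten_mapP[y /IH[Y PY ->]] /nbr_rows[->|[k [m [mM ->]]]].
  by exists Y.
by exists (Y + single k m) => //; exact: PM.
Qed.

End States.

Section Search.
Variables (T : finType) (cost : seq {ffun T -> int} -> option int).
Notation row := {ffun T -> int}.

Lemma scan_best (bx : int * seq row) L :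
  [/\ (scan cost bx L).1 <= bx.1,
      forall s c, s \in L -> cost s = Some c -> (scan cost bx L).1 <= c
    & scan cost bx L = bx \/
      exists2 s, s \in L & cost s = Some (scan cost bx L).1 /\ (scan cost bx L).2 = s].
Proof.
elim: L => [|s L [le_bx best IH]] /=; first by split=> //; left.
case cs: (cost s) => [c|].
  case: ifP => le_c.
    split=> [//|s' c'|]; first by rewrite inE => /predU1P[->|s'L]; [rewrite cs => -[<-] | exact: best].
    case: IH => [->|[s' s'L s'P]]; [by left|right].
    by exists s' => //; rewrite inE s'L orbT.
  have lt_c : c < (scan cost bx L).1 by rewrite ltNge le_c.
  split=> [|s' c'|] /=; first exact: le_trans (ltW lt_c) le_bx.
    rewrite inE => /predU1P[->|s'L c's]; first by rewrite cs => -[<-].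
    exact: le_trans (ltW lt_c) (best _ _ s'L c's).
  by right; exists s; rewrite ?mem_head.
split=> [//|s' c'|]; first by rewrite inE => /predU1P[->|s'L]; [rewrite cs | exact: best].
case: IH => [->|[s' s'L s'P]]; [by left|right].
by exists s' => //; rewrite inE s'L orbT.
Qed.

Lemma search_best K (bx : int * seq row) x Ms :
  [/\ (search cost K bx x Ms).1 <= bx.1,
      forall M s c, M \in Ms -> s \in cands K M x -> cost s = Some c ->
        (search cost K bx x Ms).1 <= c
    & search cost K bx x Ms = bx \/
      exists M s, [/\ M \in Ms, s \in cands K M x, cost s = Some (search cost K bx x Ms).1
        & (search cost K bx x Ms).2 = s]].
Proof.
elim: Ms => [|M Ms [le_bx best IH]] /=; first by split=> //; left.
have [le_s best_s IH_s] := scan_best (search cost K bx x Ms) (cands K M x).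
split=> [|M' s c|]; first exact: le_trans le_bx.
  rewrite inE => /predU1P[->|M'Ms sM' cs]; first exact: best_s.
  by apply: le_trans le_s _; exact: best sM' cs.
case: IH_s => [->|[s sM [cs s2]]].
  case: IH => [->|[M' [s [M'Ms sM' cs s2]]]]; [by left|right].
  by exists M', s; rewrite inE M'Ms orbT.
by right; exists M, s; rewrite mem_head.
Qed.

End Search.

Section Convergence.
Variables (l : nat) (T : finType).
Notation row := {ffun T -> int}.
Notation state := {ffun 'I_l -> row}.
Notation J := (T + 'I_l * T)%type.
Variables (L : row -> Prop) (G : seq row) (K : nat).
Hypothesis LB : forall a b, L a -> L b -> L (a - b).
Hypothesis GL : forall g, g \in G -> L g.
Hypothesis decompose : forall Z : state, (forall k, L (Z k)) ->
  exists2 bs, \sum_(b <- bs) block_sum b = Z &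
    forall b, b \in bs -> [/\ (size b <= K)%N, {subset map snd b <= G}
      & forall j, conf (component (block_sum b) j) (component Z j)].
Variables (phi psi : J -> int -> int) (B n : nat) (top : int) (X0 Y : state).
Hypothesis phi_cvx : forall j, convex (phi j).
Hypothesis psi_cvx : forall j, convex (psi j).
Hypothesis psi_ge0 : forall j z, 0 <= psi j z.
Hypothesis Bn : forall i, (2 ^ i <= B)%N = (i < n)%N.

Definition coset (X : state) : Prop := forall k, L (X k - X0 k).
Definition valid (X : state) : Prop :=
  [/\ coset X, energy psi X <= 0 & energy phi X <= top].

Hypothesis Y_coset : coset Y.
Hypothesis Y_psi : energy psi Y <= 0.
Hypothesis Y_min : forall X, coset X -> energy psi X <= 0 -> energy phi Y <= energy phi X.
Hypothesis XYB : forall X, valid X -> forall k t, (`|(Y k t - X k t)%R| <= B)%N.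

Definition cost (s : seq row) : option int :=
  let X := of_rows l s in
  if energy psi X <= 0 then Some (energy phi X) else None.

Definition moves : seq (seq row) := ladder G 0 n.

Lemma lattice0 g : L g -> L 0.
Proof. by move=> Lg; rewrite -(subrr g); exact: LB. Qed.

Lemma latticeN g : L g -> L (- g).
Proof. by move=> Lg; rewrite -[- g]add0r; apply: LB => //; exact: lattice0 Lg. Qed.

Lemma latticeD g h : L g -> L h -> L (g + h).
Proof. by move=> Lg Lh; rewrite -[h]opprK; apply: LB => //; exact: latticeN. Qed.

Lemma latticeMn g i : L g -> L (g *+ i).
Proof.
move=> Lg; elim: i => [|i IH]; first by rewrite mulr0n; exact: lattice0 Lg.
by rewrite mulrS; exact: latticeD.
Qed.

Lemma coset_single X k i g : coset X -> g \in G -> coset (X + single k (g *+ i)).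
Proof.
move=> cX gG k'; rewrite !ffunE; case: eqP => _; last by rewrite addr0; exact: cX.
by rewrite addrAC; apply: latticeD; [exact: cX | exact/latticeMn/GL].
Qed.

Lemma coset_cands X M s : coset X -> M \in moves -> s \in cands K M (rows X) ->
  exists2 X', coset X' & s = rows X'.
Proof.
move=> cX /mapP[i _ ->]; apply: cands_sound => // X' k m cX' /mapP[g gG ->].
exact: coset_single.
Qed.

Definition rate : nat := (2 * (l * size G).+1 ^ K)%N.

(** The best candidate is at least as good as the one given by [augmenting_block]
for the optimum [Y]. *)
Lemma improve_gap X : valid X -> exists X', [/\ valid X',
  improve cost K moves (energy phi X, rows X) = (energy phi X', rows X'),
  energy phi X' <= energy phi X
  & energy phi X - energy phi Y <= rate%:Z * (energy phi X - energy phi X')].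
Proof.
move=> vX; have [cX psiX topX] := vX.
rewrite /improve /=.
have [le_X best res] := search_best cost K (energy phi X, rows X) (rows X) moves.
have {res} [X' [vX' resE]] : exists X', valid X' /\
    search cost K (energy phi X, rows X) (rows X) moves = (energy phi X', rows X').
  case: res => [->|[M [s [MM sM cs s2]]]]; first by exists X.
  have [X' cX' def_s] := coset_cands cX MM sM.
  move: cs; rewrite /cost def_s rowsK; case: ifP => // psiX' [eX']; exists X'.
  by move: le_X s2; rewrite def_s -eX' /= => le_X s2; split; [split=> //; exact: le_trans topX|
    rewrite [LHS]surjective_pairing -eX' s2].
rewrite resE /= in le_X best *.
exists X'; split=> //.
have [lt_YX|le_XY] := ltrP (energy phi Y) (energy phi X); last first.
  have : 0 <= rate%:Z * (energy phi X - energy phi X') by rewrite mulr_ge0 // subr_ge0.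
  by apply: le_trans; rewrite subr_le0.
have [k|bs sum_bs bsP] := decompose (Z := Y - X).
  have -> : (Y - X) k = (Y k - X0 k) - (X k - X0 k).
    by rewrite !ffunE opprB addrA subrK.
  exact: LB.
have [b [a [bK bG aB psiXb gap]]] :=
  augmenting_block phi_cvx psi_cvx psi_ge0 sum_bs bsP psiX Y_psi lt_YX (XYB vX).
apply: le_trans gap _; rewrite ler_wpM2l // lerB //.
apply: (best [seq g *+ 2 ^ a | g <- G] (rows (X + block_sum b *+ 2 ^ a))).
- by apply/mapP; exists a; rewrite // mem_iota add0n /= -Bn.
- exact: cands_complete.
- by rewrite /cost rowsK psiXb.
Qed.

(** A round that starts with a gap of at least [2 ^ j] lowers the gap by at least
[2 ^ j / rate], so [q] counts the rounds left until the gap is below [2 ^ j],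
and [rate] rounds suffice to halve it.  The last round sees no improvement. *)
Lemma descend_converges X j q : valid X -> (q <= rate)%N ->
    rate%:Z * (energy phi X - energy phi Y) < (rate + q)%N%:Z * (2 ^ j)%N%:Z ->
  exists i X', [/\ (i <= rate * j + q + 1)%N, valid X', energy phi X' = energy phi Y
    & descend cost K moves i (energy phi X, rows X) = Some (energy phi X', rows X')].
Proof.
have rate_gt0 : 0 < rate%:Z by rewrite ltz_nat muln_gt0 expn_gt0.
have stop Z : valid Z -> energy phi Z - energy phi Y < 1 ->
    energy phi Z = energy phi Y /\
    descend cost K moves 1 (energy phi Z, rows Z) = Some (energy phi Z, rows Z).
  move=> vZ; have [cZ psiZ _] := vZ; have := Y_min cZ psiZ => le_YZ lt_Z.
  have eZ : energy phi Z = energy phi Y by lia.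
  have [X' [[cX' psiX' _] eX' _ _]] := improve_gap vZ.
  by rewrite /= eX' /= eZ Y_min.
elim: j q X => [|j IHj].
  elim=> [|q IHq] X vX q_rate.
    rewrite addn0 ltr_pM2l // => /(stop X vX)[eX dX].
    by exists 1%N, X; split=> //; lia.
  move=> gapX.
  have [lt1|ge1] := ltrP (energy phi X - energy phi Y) 1.
    by have [eX dX] := stop X vX lt1; exists 1%N, X; split=> //; lia.
  have [X' [vX' eX' leX' gapX']] := improve_gap vX.
  have [||i [Z [iq vZ eZ dZ]]] := IHq X' vX'; first exact: ltnW.
    move: gapX gapX' ge1; rewrite !mulr1 addnS; move: (rate%:Z) => r; nia.
  exists i.+1, Z; split=> //; first lia.
  rewrite /= eX' /= dZ ifF //; apply/negbTE; rewrite -ltNge.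
  by rewrite -(ltr_pM2l rate_gt0); move: gapX' ge1; nia.
elim=> [|q IHq] X vX q_rate gapX.
  have [//||i [Z [iq vZ eZ dZ]]] := IHj rate X vX.
    by move: gapX; rewrite addn0 expnS; lia.
  by exists i, Z; split=> //; lia.
have [lt1|ge1] := ltrP (energy phi X - energy phi Y) (2 ^ j.+1)%N%:Z.
  have [||i [Z [iq vZ eZ dZ]]] := IHq X vX; first exact: ltnW.
    apply: (@lt_le_trans _ _ (rate%:Z * (2 ^ j.+1)%N%:Z)); first by rewrite ltr_pM2l.
    by rewrite ler_wpM2r // lez_nat leq_addr.
  by exists i, Z; split=> //; lia.
have pow_gt0 : 0 < (2 ^ j.+1)%N%:Z by rewrite ltz_nat expn_gt0.
have [X' [vX' eX' leX' gapX']] := improve_gap vX.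
have [||i [Z [iq vZ eZ dZ]]] := IHq X' vX'; first exact: ltnW.
  move: gapX gapX' ge1; rewrite addnS; move: (2 ^ j.+1)%N => p; move: (rate) => r; nia.
exists i.+1, Z; split=> //; first lia.
rewrite /= eX' /= dZ ifF //; apply/negbTE; rewrite -ltNge.
rewrite -subr_gt0 -(pmulr_rgt0 _ rate_gt0).
by apply: lt_le_trans gapX'; apply: lt_le_trans ge1.
Qed.

End Convergence.

(** * Sums over rows and states *)

Section GraphTerms.
Variable E : Type.

Definition tPad (n : nat) (t : term E) : term E := iter n (TCons (Lit 0)) t.

Definition tInts (s : seq int) : term E := foldr (fun z => TCons (Lit z)) TNil s.

Definition tMatrix (M : seq (seq int)) : term E :=
  foldr (fun s => TCons (tInts s)) TNil M.

Definition init_body (n : nat) : term E :=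
  Case (Var 0) TNil (TCons (tPad n (Var 0)) (App (Var 3) (Var 1))).
Definition tInit n := Fun (init_body n).

Definition negpad_body (n : nat) : term E :=
  Case (Var 0) (tPad n TNil) (TCons (TSub (Lit 0) (Var 0)) (App (Var 3) (Var 1))).
Definition tNegpad n := Fun (negpad_body n).

Definition sum_body : term E :=
  Case (Var 0) (Lit 0) (TAdd (Var 0) (App (Var 3) (Var 1))).
Definition tSum := Fun sum_body.

(** [p |-> z |-> D |-> p *+ size D + z] *)
Definition addmul_body : term E :=
  Case (Var 0) (Var 2) (TAdd (Var 6) (App (Var 3) (Var 1))).
Definition tAddmul := Fun (Fun (Fun addmul_body)).

(** [g |-> x |-> g + \sum_(r <- x) r] *)
Definition colsum_body : term E :=
  Case (Var 0) (Var 2) (tApp2 (tAddrow E) (Var 0) (App (Var 3) (Var 1))).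
Definition tColsum := Fun (Fun colsum_body).

(** One summand for each element of the list in variable [j].  Each [q] finds the
element in variable 0 and its commodity in variable [d]; this index moves by two
with each [Case].  The recursion is unrolled at the level of terms since an
oracle call names its edge in the program text. *)
Fixpoint tRow (j d : nat) (qs : seq (nat -> term E)) : term E :=
  if qs is q :: qs' then Case (Var j) (Lit 0) (TAdd (q d) (tRow 1 d.+2 qs'))
  else Lit 0.

(** The commodity of a row is obtained by counting, as oracle calls need it as an
integer. *)
Definition rows_body (qs : seq (nat -> term E)) : term E :=
  Fun (Case (Var 0) (Lit 0)
    (TAdd (tRow 0 6 qs) (tApp2 (Var 5) (TAdd (Var 4) (Lit 1)) (Var 1)))).
Definition tRows qs := Fun (rows_body qs).

Definition tTotal (colq rowq : seq (nat -> term E)) (tg tx : term E) : term E :=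
  TAdd (tLet (tApp2 tColsum tg tx) (tRow 0 2 colq)) (tApp2 (tRows rowq) (Lit 0) tx).

Fixpoint tTake (j n : nat) : term E :=
  if n is n'.+1 then Case (Var j) TNil (TCons (Var 0) (tTake 1 n')) else TNil.

Definition strip_body (n : nat) : term E :=
  Case (Var 0) TNil (TCons (tTake 0 n) (App (Var 3) (Var 1))).
Definition tStrip n := Fun (strip_body n).

End GraphTerms.

Section GraphSpecs.
Variables (G : digraph) (I : instance G) (b : nat).
Notation E := (edge G).
Implicit Types (env : seq (value E)) (r : value E) (c n : nat).
Notation runs := (runs I b).

Lemma runs_pad env m t n s :
  runs env t (vints s) n -> runs env (tPad m t) (vints (nseq m 0 ++ s)) (n + 2 * m).
Proof.
move=> Ht; elim: m => [|m IH]; first by rewrite addn0.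
by eapply runs_le; [eapply runs_cons; [rsimple|exact: IH]|lia].
Qed.

Lemma runs_ints env s : runs env (tInts E s) (vints s) (2 * size s + 1).
Proof.
elim: s => [|z s IH]; first exact: runs_nil.
by eapply runs_le; [eapply runs_cons; [rsimple|exact: IH]|rewrite /=; lia].
Qed.

Lemma runs_matrix env N M : (forall s, s \in M -> size s = N) ->
  runs env (tMatrix E M) (vlist [seq vints s | s <- M]) (size M * (2 * N + 2) + 1).
Proof.
elim: M => [|s M IH] MN; first exact: runs_nil.
eapply runs_le.
  eapply runs_cons; first exact: runs_ints.
  by apply: IH => s' s'M; apply: MN; rewrite inE s'M orbT.
rewrite (MN s) ?mem_head //=; lia.
Qed.

Lemma runs_init m env0 env tf t nf n (A B : Type) (f : A -> B -> int) (s : seq A) (vs : seq B) :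
    runs env0 tf (VClos env (init_body E m)) nf ->
    runs env0 t (vlist [seq vints [seq f a v | v <- vs] | a <- s]) n ->
  runs env0 (App tf t) (vlist [seq vints (nseq m 0 ++ [seq f a v | v <- vs]) | a <- s])
    (nf + n + size s * (2 * m + 20) + 10).
Proof.
elim: s env0 env tf t nf n => [|a s IH] env0 env tf t nf n Hf Ht.
  eapply runs_le; first by eapply runs_app; [exact: Hf|exact: Ht|eapply runs_case_nil; rsimple].
  rewrite /=; lia.
eapply runs_le.
  eapply runs_app; [exact: Hf|exact: Ht|].
  eapply runs_case_cons; first rsimple.
  eapply runs_cons; first (eapply runs_pad; rsimple).
  by eapply IH; rsimple.
rewrite /=; lia.
Qed.

Lemma runs_negpad m env0 env tf t nf n s :
    runs env0 tf (VClos env (negpad_body E m)) nf -> runs env0 t (vints s) n ->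
  runs env0 (App tf t) (vints ([seq - z | z <- s] ++ nseq m 0))
    (nf + n + size s * 20 + 2 * m + 10).
Proof.
elim: s env0 env tf t nf n => [|z s IH] env0 env tf t nf n Hf Ht.
  eapply runs_le.
    eapply runs_app; [exact: Hf|exact: Ht|eapply runs_case_nil; first rsimple].
    rewrite -[_ ++ _]cats0; apply: runs_pad; exact: (runs_nil (G := G)).
  rewrite /=; lia.
eapply runs_le.
  eapply runs_app; [exact: Hf|exact: Ht|].
  eapply runs_case_cons; first rsimple.
  rewrite /= -[- z]add0r.
  eapply runs_cons; first rsimple.
  by eapply IH; rsimple.
rewrite /=; lia.
Qed.

Lemma runs_sum env0 env tf t nf n s :
    runs env0 tf (VClos env (sum_body E)) nf -> runs env0 t (vints s) n ->
  runs env0 (App tf t) (VInt (\sum_(z <- s) z)) (nf + n + size s * 20 + 10).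
Proof.
elim: s env0 env tf t nf n => [|z s IH] env0 env tf t nf n Hf Ht.
  rewrite big_nil; eapply runs_le.
    by eapply runs_app; [exact: Hf|exact: Ht|eapply runs_case_nil; rsimple].
  rewrite /=; lia.
rewrite big_cons; eapply runs_le.
  eapply runs_app; [exact: Hf|exact: Ht|].
  eapply runs_case_cons; first rsimple.
  eapply runs_add; first rsimple.
  by eapply IH; rsimple.
rewrite /=; lia.
Qed.

Lemma runs_addmul env0 env v1 v2 tf t nf n (p z : int) (A : Type) (f : A -> value E) (s : seq A) :
    runs env0 tf (VClos (VInt z :: v1 :: VInt p :: v2 :: env) (addmul_body E)) nf ->
    runs env0 t (vlist [seq f a | a <- s]) n ->
  runs env0 (App tf t) (VInt (p *+ size s + z)) (nf + n + size s * 20 + 10).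
Proof.
elim: s env0 env v1 v2 tf t nf n => [|a s IH] env0 env v1 v2 tf t nf n Hf Ht.
  rewrite mulr0n add0r; eapply runs_le.
    by eapply runs_app; [exact: Hf|exact: Ht|eapply runs_case_nil; rsimple].
  rewrite /=; lia.
rewrite mulrS -addrA; eapply runs_le.
  eapply runs_app; [exact: Hf|exact: Ht|].
  eapply runs_case_cons; first rsimple.
  eapply runs_add; first rsimple.
  by eapply IH; rsimple.
rewrite /=; lia.
Qed.

Lemma runs_take env m j (s1 s2 : seq int) : size s1 = m ->
    onth env j = Some (vints (s1 ++ s2)) ->
  runs env (tTake E j m) (vints s1) (4 * m + 1).
Proof.
elim: m j env s1 => [|m IH] j env [|z s1] //= => [_ _|[sz] Hj]; first exact: runs_nil.
eapply runs_le.
  eapply runs_case_cons; first by eapply runs_var; exact: Hj.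
  eapply runs_cons; first rsimple.
  by apply: IH.
lia.
Qed.

Lemma runs_strip m env0 env tf t nf n (A : Type) (f g : A -> seq int) (s : seq A) :
    (forall a, size (f a) = m) ->
    runs env0 tf (VClos env (strip_body E m)) nf ->
    runs env0 t (vlist [seq vints (f a ++ g a) | a <- s]) n ->
  runs env0 (App tf t) (vlist [seq vints (f a) | a <- s])
    (nf + n + size s * (4 * m + 20) + 10).
Proof.
move=> fm; elim: s env0 env tf t nf n => [|a s IH] env0 env tf t nf n Hf Ht.
  eapply runs_le; first by eapply runs_app; [exact: Hf|exact: Ht|eapply runs_case_nil; rsimple].
  rewrite /=; lia.
eapply runs_le.
  eapply runs_app; [exact: Hf|exact: Ht|].
  eapply runs_case_cons; first rsimple.
  eapply runs_cons; first by eapply runs_take; [exact: fm|reflexivity].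
  by eapply IH; rsimple.
rewrite /=; lia.
Qed.

Lemma runs_row (A : Type) (q : A -> nat -> term E) (f h : A -> int) (vk : value E) (Cq : nat)
    (s : seq A) env j d :
    (forall a env d, onth env 0 = Some (VInt (f a)) -> onth env d = Some vk ->
      runs env (q a d) (VInt (h a)) Cq) ->
    onth env j = Some (vints [seq f a | a <- s]) -> onth env d = Some vk ->
  runs env (tRow j d.+2 [seq q a | a <- s]) (VInt (\sum_(a <- s) h a))
    (size s * (Cq + 10) + 5).
Proof.
move=> qP; elim: s env j d => [|a s IH] env j d Hj Hd /=.
  by rewrite big_nil; eapply runs_le; [rsimple|lia].
rewrite big_cons; eapply runs_le.
  eapply runs_case_cons; first by eapply runs_var; exact: Hj.
  eapply runs_add; first exact: qP.
  by apply: IH.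
rewrite /=; lia.
Qed.

End GraphSpecs.

Section Total.
Variables (G : digraph) (I : instance G) (b : nat).
Notation E := (edge G).
Notation runs := (runs I b).
Variables (T : finType) (ts : seq T) (l : nat).
Notation row := {ffun T -> int}.
Notation state := {ffun 'I_l -> row}.
Hypothesis ts_perm : perm_eq ts (index_enum T).
Notation N := (size ts).

Lemma runs_colsum env0 env v tf t nf n (g : row) (x : seq row) :
    runs env0 tf (VClos (vrow ts g :: v :: env) (colsum_body E)) nf ->
    runs env0 t (vstate ts x) n ->
  runs env0 (App tf t) (vrow ts (g + \sum_(r <- x) r))
    (nf + n + size x * (20 * N + 40) + 10).
Proof.
elim: x env0 env v tf t nf n => [|r x IH] env0 env v tf t nf n Hf Ht.
  rewrite big_nil addr0; eapply runs_le.
    by eapply runs_app; [exact: Hf|exact: Ht|eapply runs_case_nil; rsimple].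
  rewrite /=; lia.
rewrite big_cons addrCA; eapply runs_le.
  eapply runs_app; [exact: Hf|exact: Ht|].
  eapply runs_case_cons; first rsimple.
  eapply runs_addrow; first rsimple.
  by eapply IH; rsimple.
rewrite /=; lia.
Qed.

Variables (q : T -> nat -> term E) (h : 'I_l -> T -> int -> int) (X : state) (Cq : nat).
Hypothesis qP : forall k t env d, onth env 0 = Some (VInt (X k t)) ->
  onth env d = Some (VInt (val k)%:Z) -> runs env (q t d) (VInt (h k t (X k t))) Cq.

Lemma runs_rows env0 env tf t1 t2 nf n1 n2 (ks : seq 'I_l) k0 :
    map val ks = iota k0 (size ks) ->
    runs env0 tf (VClos env (rows_body [seq q t | t <- ts])) nf ->
    runs env0 t1 (VInt k0%:Z) n1 ->
    runs env0 t2 (vstate ts [seq X k | k <- ks]) n2 ->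
  runs env0 (tApp2 tf t1 t2) (VInt (\sum_(k <- ks) \sum_(t <- ts) h k t (X k t)))
    (nf + n1 + n2 + size ks * (N * (Cq + 10) + 30) + 10).
Proof.
elim: ks k0 env0 env tf t1 t2 nf n1 n2 => [|k ks IH] k0 env0 env tf t1 t2 nf n1 n2.
  move=> _ Hf H1 H2; rewrite big_nil; eapply runs_le.
    eapply runs_app; [eapply runs_app; [exact: Hf|exact: H1|eapply runs_fun]|exact: H2|].
    by eapply runs_case_nil; rsimple.
  rewrite /=; lia.
case=> k0E ksE Hf H1 H2; rewrite big_cons; eapply runs_le.
  eapply runs_app; [eapply runs_app; [exact: Hf|exact: H1|eapply runs_fun]|exact: H2|].
  eapply runs_case_cons; first rsimple.
  eapply runs_add.
    eapply (runs_row (h := fun t => h k t (X k t)) (vk := VInt (val k)%:Z)); first exact: qP.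
      by reflexivity.
    by rewrite -k0E.
  eapply (IH k0.+1); [exact: ksE|rsimple| |rsimple].
  by have -> : k0.+1%:Z = k0%:Z + 1 by [lia]; rsimple.
rewrite /=; lia.
Qed.

Variables (p : T -> nat -> term E) (hc : T -> int -> int) (g : row).
Hypothesis pP : forall t env d, onth env 0 = Some (VInt (g t + \sum_k X k t)) ->
  runs env (p t d) (VInt (hc t (g t + \sum_k X k t))) Cq.

(** The column functions are shifted by the row [g] that the program adds to the
sums over the commodities. *)
Definition separable (j : T + 'I_l * T) : int -> int :=
  match j with inl t => fun z => hc t (g t + z) | inr (k, t) => h k t end.

Lemma energy_separable : energy separable X =
  \sum_(t <- ts) hc t (g t + \sum_k X k t) + \sum_k \sum_(t <- ts) h k t (X k t).
Proof.
rewrite /energy big_sumType /= (perm_big _ ts_perm); congr (_ + _).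
under [RHS]eq_bigr do rewrite (perm_big _ ts_perm).
by rewrite pair_big; apply: eq_bigr => -[k t].
Qed.

Definition total_cost := ((l + 2) * (40 * N + 2 * N * Cq + 100))%N.

Lemma runs_total env t1 t2 n1 n2 :
    runs env t1 (vrow ts g) n1 -> runs env t2 (vstate ts (rows X)) n2 ->
  runs env (tTotal [seq p t | t <- ts] [seq q t | t <- ts] t1 t2)
    (VInt (energy separable X)) (n1 + 2 * n2 + total_cost).
Proof.
move=> H1 H2; rewrite energy_separable; eapply runs_le.
  eapply runs_add.
    eapply runs_app; [eapply runs_fun| |].
      eapply runs_colsum; last exact: H2.
      by eapply runs_app; [eapply runs_fun|exact: H1|eapply runs_fun].
    have sumE t : (g + \sum_(r <- rows X) r) t = g t + \sum_k X k t.
      by rewrite ffunE big_map big_enum sum_ffunE.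
    eapply (runs_row (f := fun t => (g + \sum_(r <- rows X) r) t)
      (h := fun t => hc t (g t + \sum_k X k t))); [|reflexivity|reflexivity].
    by move=> t env' d; rewrite sumE => H0 _; exact: pP.
  have -> : \sum_k \sum_(t <- ts) h k t (X k t)
      = \sum_(k <- enum 'I_l) \sum_(t <- ts) h k t (X k t) by rewrite big_enum.
  eapply runs_rows; [|eapply runs_fun|eapply runs_lit|exact: H2].
  by rewrite val_enum_ord size_enum_ord.
rewrite size_rows size_enum_ord /total_cost mulnDr -[(2 * N * Cq)%N]mulnA.
by move: (N * Cq)%N N => a m; nia.
Qed.

End Total.

(** * Flows and penalties *)

Lemma convex_shift h a : convex h -> convex (fun z => h (a + z)).
Proof.
move=> cvx x y z xyz; have := cvx (a + x) (a + y) (a + z).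
have -> : a + z - (a + x) = z - x by lia.
have -> : a + z - (a + y) = z - y by lia.
have -> : a + y - (a + x) = y - x by lia.
by apply; lia.
Qed.

Lemma convex0 : convex (fun=> 0).
Proof. by move=> x y z _; rewrite !mulr0. Qed.

Section Penalty.
Variables (G : digraph).
Notation E := (edge G).
Notation V := (vertex G).
Notation T := (E + V)%type.
Notation row := {ffun T -> int}.

(** Amount by which the flow on an edge exceeds the capacity, for [z] the total flow
minus the capacity; nothing at a vertex. *)
Definition excess (t : T) (z : int) : int :=
  if t is inl _ then if 0 <= z then z else 0 else 0.

Definition defect (t : T) (z : int) : int :=
  if t is inl _ then if 0 <= z then 0 else 0 - z
  else if 0 <= z then z else 0 - z.

Lemma excess_ge0 t z : 0 <= excess t z.
Proof. by case: t => [e|v] //=; case: ifP. Qed.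

Lemma defect_ge0 t z : 0 <= defect t z.
Proof. case: t => [e|v] /=; case: ifP => //; lia. Qed.

Lemma excess_convex t : convex (excess t).
Proof.
case: t => [e|v]; last exact: convex0.
by move=> x y z /andP[xy yz] /=; (do 3 case: ifP => ?); nia.
Qed.

Lemma defect_convex t : convex (defect t).
Proof. by case: t => [e|v] x y z /andP[xy yz] /=; (do 3 case: ifP => ?); nia. Qed.

Definition coords : seq T := [seq inl e | e <- enum E] ++ [seq inr v | v <- enum V].

Lemma coords_perm : perm_eq coords (index_enum (T : finType)).
Proof.
apply: uniq_perm; [|exact: index_enum_uniq|move=> t].
  have inlI : injective (@inl E V) by move=> ? ? [].
  have inrI : injective (@inr E V) by move=> ? ? [].
  rewrite cat_uniq (map_inj_uniq inlI) (map_inj_uniq inrI) !enum_uniq andbT; apply/hasPn => _ /mapP[v _ ->].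
  by apply/mapP => -[].
rewrite mem_index_enum mem_cat; case: t => [e|v].
  by rewrite (map_f inl) ?mem_enum.
by rewrite (map_f inr) ?mem_enum ?orbT.
Qed.

Lemma sum_coords (F : T -> int) :
  \sum_(t <- coords) F t = \sum_e F (inl e) + \sum_v F (inr v).
Proof. by rewrite big_cat /=; congr (_ + _); rewrite big_map big_enum. Qed.

(** The artificial entry at [v] counts as flow that enters [v]. *)
Definition balance (g : row) (v : V) : int :=
  \sum_(e in delta_in v) g (inl e) - \sum_(e in delta_out v) g (inl e) + g (inr v).

Definition circulation (g : row) : Prop := forall v, balance g v = 0.

Lemma balanceB g h v : balance (g - h) v = balance g v - balance h v.
Proof.
have sumB (A : {set E}) : \sum_(e in A) (g - h) (inl e)
    = \sum_(e in A) g (inl e) - \sum_(e in A) h (inl e).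
  by rewrite -sumrB; apply: eq_bigr => e _; rewrite !ffunE.
rewrite /balance !sumB !ffunE.
move: (\sum_(e in delta_in v) g _ : int) (\sum_(e in delta_in v) h _ : int) => a b.
move: (\sum_(e in delta_out v) g _ : int) (\sum_(e in delta_out v) h _ : int) => c d.
by move: (g _ : int) (h _ : int) => x y; lia.
Qed.

Lemma circulationB g h : circulation g -> circulation h -> circulation (g - h).
Proof. by move=> g0 h0 v; rewrite balanceB g0 h0 subrr. Qed.

Variable I : instance G.
Notation l := (ncom I).
Notation state := {ffun 'I_l -> row}.

(** Meets all demands without any path in the digraph. *)
Definition start : state :=
  [ffun k => [ffun t => if t is inr v then demand I k v else 0]].

Definition negcap : row := [ffun t => if t is inl e then - (capacity I e)%:Z else 0].

Definition fval (t : T) : int -> int := if t is inl e then fcost I e else fun=> 0.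
Definition gval (k : 'I_l) (t : T) : int -> int :=
  if t is inl e then gcost I k e else fun=> 0.

Definition penalty := separable (fun _ : 'I_l => defect) excess negcap.
Definition price := separable gval fval (0 : row).

Lemma penalty_convex j : convex (penalty j).
Proof.
case: j => [t|[k t]]; last exact: defect_convex.
by apply: convex_shift; exact: excess_convex.
Qed.

Lemma penalty_ge0 j z : 0 <= penalty j z.
Proof. by case: j => [t|[k t]]; [exact: excess_ge0 | exact: defect_ge0]. Qed.

Lemma price_convex : (forall e, convex (fcost I e)) -> (forall k e, convex (gcost I k e)) ->
  forall j, convex (price j).
Proof.
move=> fc gc [t|[k [e|v]]]; [|exact: gc|exact: convex0].
by apply: convex_shift; case: t => [e|v]; [exact: fc|exact: convex0].
Qed.

Lemma coset_start X :
  coset circulation start X <-> forall k v, balance (X k) v = demand I k v.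
Proof.
have b0 k v : balance (start k) v = demand I k v.
  rewrite /balance !ffunE; rewrite !big1 ?subrr ?add0r // => e _; by rewrite !ffunE.
split=> [cX k v|bX k v]; last by rewrite balanceB bX b0 subrr.
by have := cX k v; rewrite balanceB b0 => /eqP; rewrite subr_eq0 => /eqP.
Qed.

Definition flow_of (X : state) : flow I := [ffun k => [ffun e => X k (inl e)]].
Definition state_of (x : flow I) : state :=
  [ffun k => [ffun t => if t is inl e then x k e else 0]].

Lemma state_ofK x : flow_of (state_of x) = x.
Proof. by apply/ffunP => k; apply/ffunP => e; rewrite !ffunE. Qed.

(** Since all summands of the penalty are nonnegative, the penalty bounds each of
them; this confines states of small penalty to a box. *)
Lemma penalty_term X j : penalty j (component X j) <= energy penalty X.
Proof.
rewrite /energy (bigD1 j) //= lerDl; apply: sumr_ge0 => i _; exact: penalty_ge0.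
Qed.

Lemma penalty_bounds X p : energy penalty X <= p ->
  [/\ forall e, \sum_k X k (inl e) <= (capacity I e)%:Z + p,
      forall k e, - p <= X k (inl e) & forall k v, `|X k (inr v)| <= p].
Proof.
move=> Xp; split=> [e|k e|k v].
- have := le_trans (penalty_term X (inl (inl e))) Xp.
  by rewrite /= /excess ffunE; case: ifP; lia.
- have := le_trans (penalty_term X (inr (k, inl e))) Xp.
  by rewrite /= /defect; case: ifP; lia.
- have := le_trans (penalty_term X (inr (k, inr v))) Xp.
  by rewrite /= /defect; case: ifP; lia.
Qed.

Lemma flow_of_feasible X : coset circulation start X -> energy penalty X <= 0 ->
  feasible (flow_of X).
Proof.
move=> /coset_start bX /penalty_bounds[cap pos art]; split=> [k v|e|k e].
- have X0 : X k (inr v) = 0 by have := art k v; lia.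
  rewrite -bX /balance X0 addr0.
  by congr (_ - _); apply: eq_bigr => e _; rewrite !ffunE.
- under eq_bigr do rewrite !ffunE.
  by have := cap e; rewrite addr0.
- by have := pos k e; rewrite oppr0 !ffunE.
Qed.

Lemma state_of_feasible x : feasible x ->
  coset circulation start (state_of x) /\ energy penalty (state_of x) <= 0.
Proof.
case=> bal cap pos; split.
  apply/coset_start => k v; rewrite -bal /balance !ffunE addr0.
  by congr (_ - _); apply: eq_bigr => e _; rewrite !ffunE.
apply: sumr_le0 => -[[e|v]|[k [e|v]]] _ //=.
- have -> : \sum_k state_of x k (inl e) = \sum_k x k e.
    by apply: eq_bigr => k _; rewrite !ffunE.
  have := cap e; rewrite /excess ffunE.
  by move: (\sum_k x k e : int) => s; case: ifP; lia.
- by rewrite /defect !ffunE pos.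
- by rewrite /defect !ffunE lexx.
Qed.

Lemma energy_price X : energy price X = objective (flow_of X).
Proof.
rewrite (energy_separable coords_perm) sum_coords.
under [\sum_k \sum_(t <- _) _]eq_bigr do rewrite sum_coords.
rewrite /objective big_split [RHS]big_split /=; congr (_ + _).
  rewrite [X in _ + X = _]big1 // addr0; apply: eq_bigr => e _.
  by rewrite ffunE add0r; congr fcost; apply: eq_bigr => k _; rewrite !ffunE.
rewrite [X in _ + X = _]big1 => [|k _]; last by rewrite big1.
rewrite addr0 exchange_big; apply: eq_bigr => e _; apply: eq_bigr => k _.
by rewrite !ffunE.
Qed.

Lemma objective_split (x : flow I) : objective x = ftotal I x + gtotal I x.
Proof. exact: big_split. Qed.

Definition supply : int := energy penalty start.

(** In a state of penalty at most [supply], an entry on an edge [e] is at least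
[- supply], hence at most the capacity of [e] plus [supply] times the number of
commodities, as the other entries on [e] are bounded from below and their total
from above. *)
Definition radius : int := supply *+ l + (supply + \sum_e (capacity I e)%:Z).

Lemma supplyE : supply = \sum_k \sum_v `|demand I k v|.
Proof.
rewrite /supply (energy_separable coords_perm) sum_coords.
under [\sum_k \sum_(t <- _) _]eq_bigr do rewrite sum_coords.
rewrite [X in X + _ = _](_ : _ = 0) ?add0r.
  apply: eq_bigr => k _; rewrite [X in X + _ = _]big1 ?add0r => [|e _].
    by apply: eq_bigr => v _; rewrite !ffunE /defect; case: ifP; lia.
  by rewrite !ffunE.
rewrite [X in _ + X = _]big1 // addr0 big1 // => e _.
by rewrite ffunE big1 ?addr0 /excess => [|k _]; rewrite ?ffunE //; case: ifP; lia.
Qed.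

Lemma supply_ge0 : 0 <= supply.
Proof. by apply: sumr_ge0 => j _; exact: penalty_ge0. Qed.

Lemma radius_ge0 : 0 <= radius.
Proof.
rewrite addr_ge0 ?mulrn_wge0 ?addr_ge0 ?supply_ge0 //.
by apply: sumr_ge0.
Qed.

Lemma within_radius X Y : energy penalty X <= supply -> energy penalty Y <= supply ->
  forall k t, (`|(Y k t - X k t)%R| <= `|radius|)%N.
Proof.
move=> Xp Yp k t.
have box Z : energy penalty Z <= supply -> - supply <= Z k t <= radius - supply.
  move=> /penalty_bounds[cap pos art].
  have c0 : 0 <= \sum_e (capacity I e)%:Z by apply: sumr_ge0.
  have s0 := supply_ge0.
  have sl : supply <= supply *+ l.
    have l1 : (0 < l)%N by case: (k) => i; apply: leq_ltn_trans.
    by rewrite -mulr_natl ler_peMl // natz lez_nat.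
  rewrite /radius; case: t => [e|v]; last first.
    have := art k v; move: (supply *+ l) sl (\sum_e _) c0 (Z k _ : int) => u su w w0 y.
    by move: su w0 s0; move: supply => s; lia.
  have := pos k e; have := cap e; rewrite (bigD1 k) //=.
  have others : - (supply *+ l) + supply <= \sum_(i | i != k) Z i (inl e).
    have -> : - (supply *+ l) + supply = \sum_(i < l | i != k) - supply.
      have -> : supply *+ l = \sum_(i < l) supply by rewrite sumr_const card_ord.
      by rewrite (bigD1 k) //= sumrN opprD addrAC addNr add0r.
    by apply: ler_sum => i _; exact: pos.
  have cap_e : (capacity I e)%:Z <= \sum_e (capacity I e)%:Z.
    by rewrite (bigD1 e) //= lerDl; apply: sumr_ge0.
  move: (\sum_(i | i != k) _ : int) others => w1.
  move: (\sum_e (capacity I e)%:Z : int) cap_e => w2.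
  move: (supply *+ l : int) (Z k (inl e) : int) ((capacity I e)%:Z : int) s0 => u y c.
  by move: supply => s; lia.
have := box X Xp; have := box Y Yp; have := radius_ge0.
by move: radius supply (X k t : int) (Y k t : int) => r s x y; lia.
Qed.

End Penalty.

Arguments penalty {G I} j z.
Arguments price {G I} j z.
Arguments circulation {G} g.

(** * The two phases *)

(** Integer values bounded from below are well-founded. *)
Lemma exists_minimizer (A : Type) (P : A -> Prop) (F : A -> int) (c : int) (x0 : A) :
    P x0 -> (forall x, P x -> c <= F x) ->
  exists2 y, P y & forall x, P x -> F y <= F x.
Proof.
move=> Px0 cF; have [n] := ubnP `|F x0 - c|%N.
elim: n x0 Px0 => // n IH x0 Px0 n_x0.
case: (classic (exists2 x, P x & F x < F x0)) => [[x Px lt_x]|none].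
  by apply: (IH x Px); have := cF x Px; lia.
exists x0 => // x Px; rewrite leNgt; apply/negP => lt_x.
by apply: none; exists x.
Qed.

Lemma add_lt_pow2 x1 x2 y1 y2 : (x1 < 2 ^ x2)%N -> (y1 < 2 ^ y2)%N ->
  (x1 + y1 < 2 ^ (x2 + y2))%N.
Proof. rewrite expnD; move: (2 ^ x2)%N (2 ^ y2)%N => p q; nia. Qed.

Lemma pow2_le (B i : nat) : (2 ^ i <= B)%N = (i < up_log 2 B.+1)%N.
Proof.
rewrite leqNgt [RHS]ltnNge; congr (~~ _); apply/idP/idP => [lt_B|le_i].
  exact: up_log_min.
by apply: leq_trans (up_logP _ (isT : 1 < 2)%N) _; rewrite leq_exp2l.
Qed.

Section Program.
Variables (G : digraph).
Notation E := (edge G).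
Notation V := (vertex G).
Notation T := (E + V)%type.
Notation row := {ffun T -> int}.
Variables (gens : seq row) (K : nat).
Notation nE := (size (enum E)).
Notation nV := (size (enum V)).

Definition q_excess (t : T) (d : nat) : term E :=
  if t is inl _ then IfLe (Lit 0) (Var 0) (Var 0) (Lit 0) else Lit 0.
Definition q_defect (t : T) (d : nat) : term E :=
  if t is inl _ then IfLe (Lit 0) (Var 0) (Lit 0) (TSub (Lit 0) (Var 0))
  else IfLe (Lit 0) (Var 0) (Var 0) (TSub (Lit 0) (Var 0)).
Definition q_fcost (t : T) (d : nat) : term E :=
  if t is inl e then AskF e (Var 0) else Lit 0.
Definition q_gcost (t : T) (d : nat) : term E :=
  if t is inl e then AskG e (Var d) (Var 0) else Lit 0.

Definition tPenalty (tg tx : term E) : term E :=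
  tTotal [seq q_excess t | t <- coords G] [seq q_defect t | t <- coords G] tg tx.
Definition tPrice (tx : term E) : term E :=
  tTotal [seq q_fcost t | t <- coords G] [seq q_gcost t | t <- coords G]
    (tPad (nE + nV) TNil) tx.

Definition penaltyfn_body : term E := TCons (tPenalty (Var 4) (Var 0)) TNil.
(** The test of the penalty comes first: the oracles may only be asked at feasible
flows. *)
Definition pricefn_body : term E :=
  IfLe (tPenalty (Var 16) (Var 0)) (Lit 0) (TCons (tPrice (Var 0)) TNil) TNil.

(** The environment of the first line is that of [input]; each [tLet] adds two
variables.  In this order, the bound values are the negated capacities, the
start, the cost function of the first phase, the supply, the radius, the scaled
generators and the result of the first phase.  For positive penalty this result
proves infeasibility. *)
Definition main : term E :=
  tLet (App (tNegpad E nV) (Var 2))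
  (tLet (App (tInit E nE) (Var 3))
  (tLet (Fun penaltyfn_body)
  (tLet (tPenalty (Var 4) (Var 2))
  (tLet (tApp3 (tAddmul E) (Var 0) (TAdd (Var 0) (App (tSum E) (Var 10))) (Var 9))
  (tLet (tApp3 (tLadder E) (Var 0) (Lit 1)
          (tMatrix E [seq [seq g t | t <- coords G] | g : row <- gens]))
  (tLet (tApp3 (tLoop E K) (Var 6) (Var 0) (TCons (Var 4) (Var 8)))
  (Case (Var 0) TNil
    (IfLe (Var 0) (Lit 0)
      (tLet (Fun pricefn_body)
        (Case (tApp3 (tLoop E K) (Var 0) (Var 6) (TCons (tPrice (Var 3)) (Var 3)))
          TNil (App (tStrip E nE) (Var 1))))
      (Lit 0))))))))).

Notation N := (size (coords G)).

Definition phase_cost (l n Ck j : nat) : nat :=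
  ((rate l gens K * j + 1) *
    (n * search_cost (coords G) Ck l K (size gens) + 50))%N.

Definition penaltyfn_cost (l : nat) : nat := (total_cost (coords G) l 10 + 10)%N.
Definition pricefn_cost (l : nat) : nat :=
  (2 * total_cost (coords G) l 10 + 2 * N + 20)%N.

Definition setup_cost (l n : nat) : nat :=
  (500 + 100 * N + l * (100 * N + 100) + 8 * total_cost (coords G) l 10
   + size gens * (2 * N + 2) + n * (size gens * (20 * N + 40) + 50))%N.

Definition main_cost (l n s : nat) : nat :=
  (setup_cost l n + phase_cost l n (penaltyfn_cost l) s
   + phase_cost l n (pricefn_cost l) s.+1)%N.

Variables (I : instance G) (b : nat).
Notation l := (ncom I).
Notation state := {ffun 'I_l -> row}.
Notation runs := (runs I b).

Lemma size_coords : N = (nE + nV)%N.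
Proof. by rewrite size_cat !size_map. Qed.

Lemma runs_penalty env t1 t2 n1 n2 (X : state) :
    runs env t1 (vrow (coords G) (negcap I)) n1 ->
    runs env t2 (vstate (coords G) (rows X)) n2 ->
  runs env (tPenalty t1 t2) (VInt (energy penalty X))
    (n1 + 2 * n2 + total_cost (coords G) l 10).
Proof.
apply: runs_total; first exact: coords_perm.
- move=> k [e|v] env' d H0 _; rewrite /q_defect /defect.
    eapply runs_le; first (eapply runs_ifle; [rsimple|eapply runs_var; exact: H0|]).
      instantiate (1 := 3%N); case: ifP => _; first by eapply runs_le; [rsimple|].
      by apply: (runs_sub (n1 := 1) (n2 := 1)); [rsimple|exact: runs_var].
    by [].
  eapply runs_le; first (eapply runs_ifle; [rsimple|eapply runs_var; exact: H0|]).
    instantiate (1 := 3%N); case: ifP => _.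
      by eapply runs_le; [eapply runs_var; exact: H0|].
    by apply: (runs_sub (n1 := 1) (n2 := 1)); [rsimple|exact: runs_var].
  by [].
move=> [e|v] env' d H0; rewrite /q_excess /excess.
  eapply runs_le; first (eapply runs_ifle; [rsimple|eapply runs_var; exact: H0|]).
    by instantiate (1 := 1%N); case: ifP => _; [exact: runs_var|rsimple].
  by [].
by eapply runs_le; [rsimple|].
Qed.

Lemma runs_price env t2 n2 (X : state) :
    feasible_costs_fit I b -> feasible (flow_of X) ->
    runs env t2 (vstate (coords G) (rows X)) n2 ->
  runs env (tPrice t2) (VInt (energy price X))
    (2 * N + 1 + 2 * n2 + total_cost (coords G) l 10).
Proof.
move=> fit /fit[ffit gfit] H2.
have zrow : runs env (tPad (nE + nV) TNil) (vrow (coords G) (0 : row)) (2 * N + 1).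
  have -> : vrow (coords G) (0 : row) = vints (nseq N 0 ++ [::]) :> value E.
    rewrite cats0 /vrow; congr vints.
    by elim: (coords G) => [|t ts IH] //=; rewrite ffunE IH.
  by rewrite -size_coords; eapply runs_le; [apply: runs_pad; exact: runs_nil|lia].
move: zrow H2; apply: runs_total; first exact: coords_perm.
- move=> k [e|v] env' d H0 Hd; last by eapply runs_le; [rsimple|].
  eapply runs_le; first eapply runs_askg.
  + by eapply runs_var; exact: Hd.
  + by eapply runs_var; exact: H0.
  + by have := gfit k e; rewrite !ffunE.
  by [].
move=> [e|v] env' d H0; last by eapply runs_le; [rsimple|].
eapply runs_le; first eapply runs_askf.
- by eapply runs_var; exact: H0.
- have := ffit e; rewrite ffunE add0r; congr (bitlen (fcost _ _ _) <= _)%N.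
  by apply: eq_bigr => k _; rewrite !ffunE.
by [].
Qed.

Hypothesis gensL : forall g, g \in gens -> circulation g.
Hypothesis decompose : forall Z : state, (forall k, circulation (Z k)) ->
  exists2 bs, \sum_(b <- bs) block_sum b = Z &
    forall b, b \in bs -> [/\ (size b <= K)%N, {subset map snd b <= gens}
      & forall j, conf (component (block_sum b) j) (component Z j)].

Definition nladder : nat := up_log 2 (`|radius I|.+1).
Notation MM := (moves gens nladder).

Definition computes_cost (kappa : value E) (cost : seq row -> option int) (Ck : nat) :=
  forall Z, coset circulation (start I) Z -> forall env tf t nf n,
    runs env tf kappa nf -> runs env t (vstate (coords G) (rows Z)) n ->
    runs env (App tf t) (vopt (cost (rows Z))) (nf + n + Ck).

(** The states of both phases lie within [radius] of each other because their
penalty stays at most [supply]: in the first phase it does not increase, in the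
second it is 0.  The lower bound [c] turns the initial gap into a number of
rounds. *)
Lemma runs_phase (phi psi : T + 'I_l * T -> int -> int) (j : nat) (X : state) (c : int) :
    (forall j, convex (phi j)) -> (forall j, convex (psi j)) ->
    (forall j z, 0 <= psi j z) ->
    coset circulation (start I) X -> energy psi X <= 0 ->
    (forall Z, coset circulation (start I) Z -> energy psi Z <= 0 ->
       energy phi Z <= energy phi X -> energy penalty Z <= supply I) ->
    (forall Z, coset circulation (start I) Z -> energy psi Z <= 0 ->
       c <= energy phi Z) ->
    energy phi X - c < (2 ^ j)%N%:Z ->
  exists X', [/\ coset circulation (start I) X', energy psi X' <= 0,
    forall Z, coset circulation (start I) Z -> energy psi Z <= 0 ->
      energy phi X' <= energy phi Z
  & forall kappa Ck, computes_cost kappa (cost phi psi) Ck ->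
    forall env t1 t2 t3 n1 n2 n3, runs env t1 kappa n1 ->
      runs env t2 (vstates (coords G) MM) n2 ->
      runs env t3 (vpair (coords G) (energy phi X, rows X)) n3 ->
    runs env (tApp3 (tLoop E K) t1 t2 t3)
      (vpair (coords G) (energy phi X', rows X'))
      (n1 + n2 + n3 + 10 + phase_cost l nladder Ck j)].
Proof.
move=> phi_cvx psi_cvx psi0 cX X0 box low gap.
pose P Z := coset circulation (start I) Z /\ energy psi Z <= 0.
have [|Z [cZ Z0]|Y [cY Y0] Ymin] := @exists_minimizer _ P (energy phi) c X.
- by [].
- exact: low.
have {}Ymin Z : coset circulation (start I) Z -> energy psi Z <= 0 ->
  energy phi Y <= energy phi Z by move=> cZ Z0; exact: Ymin.
have YXB Z : valid circulation phi psi (energy phi X) (start I) Z ->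
    forall k t, (`|(Y k t - Z k t)%R| <= `|radius I|)%N.
  case=> cZ Z0 leZ; apply: within_radius; first exact: box.
  by apply: box => //; exact: Ymin.
have rate_gt0 : 0 < (rate l gens K)%:Z by rewrite ltz_nat muln_gt0 expn_gt0.
have [|//||i [X' [i_le [cX' X'0 _] eX' desc]]] := descend_converges
  (@circulationB _) gensL decompose phi_cvx psi_cvx psi0 (pow2_le _) cY Y0 Ymin YXB
  (X := X) (j := j) (q := 0).
- by split.
- rewrite addn0 ltr_pM2l //; apply: le_lt_trans gap.
  by rewrite lerD2l lerN2; exact: low.
exists X'; split=> // [Z cZ Z0|kappa Ck kappaP env t1 t2 t3 n1 n2 n3 H1 H2 H3].
  by rewrite eX'; exact: Ymin.
pose D s := exists2 Z, coset circulation (start I) Z & s = rows Z.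
have DX : D (energy phi X, rows X).2 by exists X.
eapply runs_le.
  eapply (runs_loop (D := D) (MM := moves gens nladder) (K := K) (l := l) (Mmax := size gens) (cost := cost phi psi) (Ck := Ck)).
  - by move=> _ [Z cZ ->] env' tf t nf n; exact: kappaP.
  - by move=> _ [Z cZ ->]; exact: size_rows.
  - by move=> M /mapP[a _ ->]; rewrite size_map.
  - move=> _ [Z cZ ->] M s MM_M; exact: (coset_cands (@circulationB G) gensL cZ MM_M).
  - exact: DX.
  - exact: desc.
  - eapply runs_app; [|exact: H2|eapply runs_fun].
    by eapply runs_app; [eapply runs_fun|exact: H1|eapply runs_fun].
  - exact: H3.
rewrite /loop_cost /moves /ladder size_map size_iota /phase_cost.
set u := (nladder * _ + 50)%N.
have : (i * u <= (rate l gens K * j + 1) * u)%N by rewrite leq_mul2r addn0 in i_le *; rewrite i_le orbT.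
lia.
Qed.


Lemma runs_let env t1 t2 r1 r n1 n2 :
  runs env t1 r1 n1 -> runs (r1 :: VClos env t2 :: env) t2 r n2 ->
  runs env (tLet t1 t2) r (n1 + n2 + 2).
Proof.
move=> H1 H2; eapply runs_le; first by eapply runs_app; [eapply runs_fun|exact: H1|exact: H2].
lia.
Qed.

Lemma energy0 (X : state) : energy (fun _ _ => 0) X = 0.
Proof. exact: big1. Qed.

Lemma computes_penalty env : onth env 2 = Some (vrow (coords G) (negcap I)) ->
  computes_cost (VClos env penaltyfn_body) (cost (penalty (I := I)) (fun _ _ => 0)) (penaltyfn_cost l).
Proof.
move=> env2 Z cZ env0 tf t nf n Hf Ht; rewrite /cost rowsK energy0 lexx.
eapply runs_le.
  eapply runs_app; [exact: Hf|exact: Ht|].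
  by eapply runs_cons; [eapply runs_penalty; [eapply runs_var; exact: env2|rsimple]|rsimple].
rewrite /penaltyfn_cost; lia.
Qed.

Lemma computes_price env : feasible_costs_fit I b ->
    onth env 14 = Some (vrow (coords G) (negcap I)) ->
  computes_cost (VClos env pricefn_body) (cost (price (I := I)) (penalty (I := I))) (pricefn_cost l).
Proof.
move=> fit env14 Z cZ env0 tf t nf n Hf Ht; rewrite /cost rowsK.
eapply runs_le.
  eapply runs_app; [exact: Hf|exact: Ht|].
  eapply runs_ifle; [eapply runs_penalty; [eapply runs_var; exact: env14|rsimple]|rsimple|].
  instantiate (1 := (2 * N + 8 + total_cost (coords G) l 10)%N).
  case: ifP => Z0; last by eapply runs_le; [rsimple|lia].
  eapply runs_le.
    eapply runs_cons; last rsimple.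
    by apply: runs_price fit (flow_of_feasible cZ Z0) _; rsimple.
  lia.
rewrite /pricefn_cost; lia.
Qed.

Lemma inputE : input I = [:: VInt l;
  vlist [seq vints [seq demand I k v | v <- enum V] | k <- enum 'I_l];
  vints [seq (capacity I e)%:Z | e <- enum E]].
Proof.
rewrite /input /vints -map_comp; congr [:: _; vlist _; _].
by apply: eq_map => k; rewrite -map_comp.
Qed.

Lemma vrow_negcap :
  vints ([seq - z | z <- [seq (capacity I e)%:Z | e <- enum E]] ++ nseq nV 0)
  = vrow (coords G) (negcap I) :> value E.
Proof.
rewrite /vrow /coords map_cat; congr (vints (_ ++ _)).
  by rewrite -[LHS]map_comp -[RHS]map_comp; apply: eq_map => e /=; rewrite ffunE.
by rewrite -[RHS]map_comp; elim: (enum V) => //= v vs ->; rewrite ffunE.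
Qed.

Lemma vstate_start :
  vlist [seq vints (nseq nE 0 ++ [seq demand I k v | v <- enum V]) | k <- enum 'I_l]
  = vstate (coords G) (rows (start I)) :> value E.
Proof.
rewrite /vstate /rows -map_comp; congr vlist; apply: eq_map => k /=.
rewrite /vrow /coords map_cat; congr (vints (_ ++ _)).
  by rewrite -[RHS]map_comp; elim: (enum E) => //= e es ->; rewrite !ffunE.
by rewrite -[RHS]map_comp; apply: eq_map => v /=; rewrite !ffunE.
Qed.

Lemma vstate_gens : vstate (coords G) [seq g *+ 2 ^ 0 | g <- gens]
  = vlist [seq vints w | w <- [seq [seq (g : row) t | t <- coords G] | g : row <- gens]]
  :> value E.
Proof.
elim: gens => //= g M; rewrite /vstate /= => <-.
by rewrite mulr1n.
Qed.

Lemma vstate_rows (X : state) : vstate (coords G) (rows X)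
  = vlist [seq vints ([seq X k (inl e) | e <- enum E] ++ [seq X k (inr v) | v <- enum V])
          | k <- enum 'I_l] :> value E.
Proof.
rewrite /vstate /rows -map_comp; congr vlist; apply: eq_map => k /=.
rewrite /vrow /coords map_cat; congr (vints (_ ++ _)).
  by rewrite -[LHS]map_comp.
by rewrite -[LHS]map_comp.
Qed.

Lemma flow_outputE (X : state) :
  vlist [seq vints [seq X k (inl e) | e <- enum E] | k <- enum 'I_l]
  = flow_output (flow_of X).
Proof.
congr vlist; apply: eq_map => k; rewrite /vints -map_comp; congr vlist.
by apply: eq_map => e /=; rewrite !ffunE.
Qed.


Lemma sum_lt_pow2 (A : finType) (f w : A -> nat) :
  (forall a, f a < 2 ^ w a)%N -> (\sum_a f a < 2 ^ \sum_a w a)%N.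
Proof.
move=> fw; elim/big_ind2: _ => // x1 x2 y1 y2 lt1 lt2.
exact: add_lt_pow2.
Qed.

Lemma abs_lt_pow2 z : (`|z| < 2 ^ bitlen z)%N.
Proof. by rewrite -bitlen_le. Qed.

Lemma runs_main fhat ghat s :
    (forall e, convex (fcost I e)) -> (forall k e, convex (gcost I k e)) ->
    is_max_abs (ftotal I) fhat -> is_max_abs (gtotal I) ghat ->
    feasible_costs_fit I b ->
    supply I < (2 ^ s)%N%:Z -> (2 * (fhat + ghat))%N%:Z < (2 ^ s.+1)%N%:Z ->
  exists2 r, runs (input I) main r (main_cost l nladder s) & solves I r.
Proof.
move=> f_cvx g_cvx [f_le _] [g_le _] fit supply_s price_s.
have cS : coset circulation (start I) (start I) by move=> k v; rewrite balanceB subrr.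
have [||//|//||//|||X1 [cX1 _ X1min run1]] := @runs_phase penalty (fun _ _ => 0) s (start I) 0.
- exact: penalty_convex.
- by move=> j; exact: convex0.
- by rewrite energy0.
- by move=> Z _ _; apply: sumr_ge0 => j _; exact: penalty_ge0.
- by rewrite subr0.
(* the first phase has no side condition, so [X1] minimises the penalty over all states *)
have {}X1min Z : coset circulation (start I) Z -> energy penalty X1 <= energy penalty Z.
  by move=> cZ; apply: X1min => //; rewrite energy0.
(* the part of the program before the decision, common to both outcomes *)
have main_run r n : (n <= phase_cost l nladder (pricefn_cost l) s.+1
    + 4 * total_cost (coords G) l 10 + 300 + 20 * N + l * (4 * N + 20))%N ->
    (forall env, onth env 4 = Some (vstates (coords G) MM) ->
       onth env 14 = Some (vrow (coords G) (negcap I)) ->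
       onth env 1 = Some (vstate (coords G) (rows X1)) ->
       onth env 0 = Some (VInt (energy penalty X1)) ->
       runs env (IfLe (Var 0) (Lit 0)
      (tLet (Fun pricefn_body)
        (Case (tApp3 (tLoop E K) (Var 0) (Var 6) (TCons (tPrice (Var 3)) (Var 3)))
          TNil (App (tStrip E nE) (Var 1))))
      (Lit 0)) r n) ->
    runs (input I) main r (main_cost l nladder s).
  move=> n_le tail; rewrite inputE; eapply runs_le.
    eapply runs_let; first (eapply runs_negpad; rsimple).
    rewrite vrow_negcap.
    eapply runs_let; first (eapply runs_init; rsimple).
    rewrite vstate_start.
    eapply runs_let; first rsimple.
    eapply runs_let; first (eapply runs_penalty; rsimple).
    eapply runs_let.
      eapply runs_addmul; last rsimple.
      eapply runs_app; [|eapply runs_add; [rsimple|eapply runs_sum; rsimple]|eapply runs_fun].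
      by eapply runs_app; [eapply runs_fun|rsimple|eapply runs_fun].
    have -> : energy penalty (start I) *+ size (enum 'I_l)
        + (energy penalty (start I) + \sum_(z <- [seq (capacity I e)%:Z | e <- enum E]) z)
      = `|radius I|%N%:Z.
      by rewrite big_map big_enum size_enum_ord gez0_abs ?radius_ge0.
    eapply runs_let.
      eapply (runs_ladder (ts := coords G) (M := gens) (a := 0)); [exact: pow2_le|by eapply runs_app; [eapply runs_fun|rsimple|eapply runs_fun]|eapply runs_lit|].
      rewrite vstate_gens.
      by apply: (@runs_matrix _ _ _ _ N) => _ /mapP[g _ ->]; rewrite size_map.
    eapply runs_let.
      by eapply run1; [|rsimple|rsimple|rsimple]; exact: computes_penalty.
    eapply runs_case_cons; first rsimple.
    by apply: tail.
  have capE : size [seq (capacity I e)%:Z | e <- enum E] = nE by rewrite size_map.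
  have gensE : size [seq [seq (g : row) t | t <- coords G] | g : row <- gens] = size gens.
    by rewrite size_map.
  rewrite capE gensE size_enum_ord /main_cost /setup_cost -/nladder.
  have lE : (l * nE <= l * N)%N by rewrite leq_mul2l size_coords leq_addr orbT.
  have EN := size_coords.
  move: n_le; move: (phase_cost l _ _ s.+1) (phase_cost l _ _ s) (total_cost _ _ _) => c1 c2 c3.
  move: (nladder * _)%N (size gens * _)%N => c4 c5.
  move: nE nV N EN lE => m1 m2 m3 EN lE. nia.
have [X1_0|X1_gt0] := lerP (energy penalty X1) 0; last first.
  exists (VInt 0); last first.
    right; split=> //; right=> x /state_of_feasible[cx x0].
    by have := le_lt_trans (le_trans (X1min _ cx) x0) X1_gt0; rewrite ltxx.
  apply: (main_run _ 10%N); first lia.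
  move=> env _ _ _ env0; eapply runs_le.
    by eapply runs_ifle; [eapply runs_var; exact: env0|rsimple|rewrite leNgt X1_gt0; rsimple].
  by [].
have bound Z : coset circulation (start I) Z -> energy penalty Z <= 0 ->
    `|energy price Z| <= (fhat + ghat)%N%:Z.
  move=> cZ Z0; have fZ := flow_of_feasible cZ Z0.
  by have := f_le _ fZ; have := g_le _ fZ; rewrite energy_price objective_split; lia.
have [|||//|//||||X2 [cX2 X2_0 X2min run2]] :=
  @runs_phase price penalty s.+1 X1 (- (fhat + ghat)%N%:Z).
- exact: price_convex.
- exact: penalty_convex.
- exact: penalty_ge0.
- by move=> Z cZ Z0 _; exact: le_trans Z0 (supply_ge0 I).
- by move=> Z cZ /(bound Z cZ); lia.
- by have := bound _ cX1 X1_0; lia.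
exists (flow_output (flow_of X2)); last first.
  left; exists (flow_of X2) => //; split=> [|y fy]; first exact: flow_of_feasible.
  have [cy y0] := state_of_feasible fy.
  by have := X2min _ cy y0; rewrite !energy_price state_ofK.
apply: main_run => [|env env4 env14 env1 env0]; last first.
  eapply runs_ifle; [eapply runs_var; exact: env0|rsimple|rewrite X1_0].
  eapply runs_let; first rsimple.
  eapply runs_case_cons.
    eapply run2; [|rsimple|eapply runs_var; exact: env4|]; first exact: computes_price.
    eapply runs_cons; last by eapply runs_var; exact: env1.
    eapply runs_price; [exact: fit|exact: flow_of_feasible|].
    by eapply runs_var; exact: env1.
  rewrite -flow_outputE.
  eapply (runs_strip (f := fun k => [seq X2 k (inl e) | e <- enum E])
    (g := fun k => [seq X2 k (inr v) | v <- enum V])); [|eapply runs_fun|].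
    by move=> k; rewrite size_map.
  by eapply runs_var; rewrite /= vstate_rows.
rewrite size_enum_ord.
have lE : (l * nE <= l * N)%N by rewrite leq_mul2l size_coords leq_addr orbT.
move: (phase_cost _ _ _ _) (total_cost _ _ _) nE N lE => c1 c2 m1 m2 lE; nia.
Qed.

End Program.

(** * Polynomial bounds *)

(** The arguments stand for the number of commodities, the number of scales and the
size of the input, which bounds the other two. *)
Definition poly_bounded (f : nat -> nat -> nat -> nat) : Prop :=
  exists p : {poly nat}, forall l n s, (l <= s)%N -> (n <= s)%N -> (f l n s <= p.[s])%N.

Lemma poly_bounded_const c : poly_bounded (fun _ _ _ => c).
Proof. by exists c%:P => l n s _ _; rewrite hornerC. Qed.

Lemma poly_bounded_1 : poly_bounded (fun l _ _ => l).
Proof. by exists 'X => l n s ls _; rewrite hornerX. Qed.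

Lemma poly_bounded_2 : poly_bounded (fun _ n _ => n).
Proof. by exists 'X => l n s _ ns; rewrite hornerX. Qed.

Lemma poly_bounded_3 : poly_bounded (fun _ _ s => s).
Proof. by exists 'X => l n s _ _; rewrite hornerX. Qed.

Lemma poly_bounded_add f g : poly_bounded f -> poly_bounded g ->
  poly_bounded (fun l n s => f l n s + g l n s)%N.
Proof.
move=> [p fp] [q gq]; exists (p + q) => l n s ls ns; rewrite hornerD.
by apply: leq_add; [exact: fp | exact: gq].
Qed.

Lemma poly_bounded_mul f g : poly_bounded f -> poly_bounded g ->
  poly_bounded (fun l n s => f l n s * g l n s)%N.
Proof.
move=> [p fp] [q gq]; exists (p * q) => l n s ls ns; rewrite hornerM.
by apply: leq_mul; [exact: fp | exact: gq].
Qed.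

Lemma poly_bounded_succ f : poly_bounded f -> poly_bounded (fun l n s => (f l n s).+1).
Proof.
move=> /(poly_bounded_add (poly_bounded_const 1))[p fp].
by exists p => l n s ls ns; exact: fp.
Qed.

Lemma poly_bounded_exp f k : poly_bounded f -> poly_bounded (fun l n s => f l n s ^ k)%N.
Proof.
move=> bf; elim: k => [|k IH]; first exact: (poly_bounded_const 1).
have [p fp] := poly_bounded_mul bf IH.
by exists p => l n s ls ns; rewrite expnS; exact: fp.
Qed.

Lemma horner_nat_le (p : {poly nat}) m n : (m <= n)%N -> (p.[m] <= p.[n])%N.
Proof.
move=> mn; rewrite !horner_coef; apply: leq_sum => i _.
rewrite !natrME !natrXE leq_mul2l; apply/orP; right.
by case: (val i) => [|k]; rewrite ?expn0 // leq_exp2r.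
Qed.

Lemma main_cost_poly (G : digraph) (gens : seq {ffun edge G + vertex G -> int}) (K : nat) :
  poly_bounded (main_cost gens K).
Proof.
rewrite /main_cost /setup_cost /phase_cost /penaltyfn_cost /pricefn_cost /rate
  /search_cost /cands_cost /nbrs_cost /nbr_cost /total_cost.
move: (size (coords G)) (size gens) => N m.
repeat match goal with
  | |- poly_bounded (fun l n s => addn (@?f l n s) (@?g l n s)) =>
      apply: (@poly_bounded_add f g)
  | |- poly_bounded (fun l n s => muln (@?f l n s) (@?g l n s)) =>
      apply: (@poly_bounded_mul f g)
  | |- poly_bounded (fun l n s => expn (@?f l n s) ?k) =>
      apply: (@poly_bounded_exp f k)
  | |- poly_bounded (fun _ _ _ => ?c) => exact: (poly_bounded_const c)
  | |- poly_bounded (fun l _ _ => l) => exact: poly_bounded_1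
  | |- poly_bounded (fun _ n _ => n) => exact: poly_bounded_2
  | |- poly_bounded (fun _ _ s => s) => exact: poly_bounded_3
  | |- poly_bounded (fun l n s => S (@?f l n s)) => apply: (@poly_bounded_succ f)
  end.
Qed.

(** * Sizes *)

Section Sizes.
Variables (G : digraph) (I : instance G) (fhat ghat : nat).
Notation l := (ncom I).
Notation s := (input_size I fhat ghat).

Lemma sum_Posz (A : finType) (f : A -> nat) :
  (\sum_a f a)%N%:Z = \sum_a (f a)%:Z.
Proof. exact: (big_morph Posz PoszD erefl). Qed.

Lemma supply_nat : supply I = (\sum_k \sum_v `|demand I k v|)%N%:Z.
Proof.
rewrite supplyE sum_Posz; apply: eq_bigr => k _; rewrite sum_Posz.
by apply: eq_bigr => v _; rewrite abszE.
Qed.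

Lemma demands_lt : (\sum_k \sum_v `|demand I k v| < 2 ^ \sum_k \sum_v bitlen (demand I k v))%N.
Proof. by do 2 (apply: sum_lt_pow2 => ?); exact: abs_lt_pow2. Qed.

Lemma capacities_lt : (\sum_e capacity I e < 2 ^ \sum_e bitlen (capacity I e))%N.
Proof. by apply: sum_lt_pow2 => e; exact: (abs_lt_pow2 (capacity I e)). Qed.

Lemma supply_lt : supply I < (2 ^ s)%N%:Z.
Proof.
rewrite supply_nat ltz_nat; apply: leq_trans demands_lt _.
by rewrite leq_exp2l // /input_size; lia.
Qed.

Lemma fghat_lt : (2 * (fhat + ghat))%N%:Z < (2 ^ s.+1)%N%:Z.
Proof.
rewrite ltz_nat expnS ltn_pmul2l //.
apply: leq_trans (add_lt_pow2 (abs_lt_pow2 fhat) (abs_lt_pow2 ghat)) _.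
by rewrite leq_exp2l // /input_size; lia.
Qed.

(** The radius arises from numbers of the input by sums and products, which stay
below the power of two of the added lengths. *)
Lemma nladder_le : (nladder I <= s)%N.
Proof.
apply: up_log_min => //.
have -> : radius I = (l * (\sum_k \sum_v `|demand I k v|)
    + \sum_k \sum_v `|demand I k v| + \sum_e capacity I e)%N%:Z.
  by rewrite /radius supply_nat -sum_Posz -mulr_natl natz -!PoszM -!PoszD addnA.
apply: (@leq_trans (2 ^ (l + \sum_k \sum_v bitlen (demand I k v)
  + \sum_e bitlen (capacity I e))))%N; last by rewrite leq_exp2l // /input_size; lia.
rewrite /= add_lt_pow2 ?capacities_lt // expnD.
have := ltn_expl l (isT : (1 < 2)%N); have := demands_lt.
move: (\sum_k \sum_v _)%N (2 ^ \sum_k _)%N (2 ^ l)%N => x y z; nia.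
Qed.

Lemma ncom_le : (l <= s)%N.
Proof. by rewrite /input_size; lia. Qed.

Lemma vlist_fits m (vs : seq (value (edge G))) :
  value_fits m (vlist vs) = all (value_fits m) vs.
Proof. by elim: vs => //= v vs ->. Qed.

Lemma input_fits : all (value_fits s.+1) (input I).
Proof.
rewrite /input /= !vlist_fits andbT; apply/and3P; split.
- by apply: (@leq_trans l.+1); [rewrite bitlen_le ltn_expl | exact: ncom_le].
- rewrite all_map; apply/allP => k _ /=; rewrite vlist_fits all_map.
  apply/allP => v _ /=; rewrite /input_size.
  have : (bitlen (demand I k v) <= \sum_k \sum_v bitlen (demand I k v))%N.
    by rewrite (bigD1 k) //= (bigD1 v) //= -addnA leq_addr.
  lia.
rewrite all_map; apply/allP => e _ /=; rewrite /input_size.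
have : (bitlen (capacity I e) <= \sum_e bitlen (capacity I e))%N.
  by rewrite (bigD1 e) //= leq_addr.
lia.
Qed.

End Sizes.

Theorem theorem2p6 (G : digraph) :
  exists (t : term (edge G)) (p : {poly nat}),
    forall (I : instance G) (fhat ghat b : nat),
      (forall e, convex (fcost I e)) ->
      (forall k e, convex (gcost I k e)) ->
      is_max_abs (ftotal I) fhat ->
      is_max_abs (gtotal I) ghat ->
      feasible_costs_fit I b ->
      exists (r : value (edge G)) (c : nat),
        [/\ eval I (p.[(input_size I fhat ghat + b)%N])%R (input I) t r c,
            solves I r
          & (c <= (p.[input_size I fhat ghat])%R)%N].
Proof.
have [gens [K [gensL decompose]]] := block_decomposition (@circulationB G).
have [p cost_le] := main_cost_poly gens K.
pose q : {poly nat} := p + 'X + (term_bits (main gens K)).+1%:P.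
exists (main gens K), q => I fhat ghat b f_cvx g_cvx f_max g_max fit.
have qE x : q.[x] = (p.[x] + x + (term_bits (main gens K)).+1)%N.
  by rewrite /q !hornerD hornerX hornerC.
have [r [c run_c c_le] r_ok] := runs_main gensL (decompose (ncom I)) f_cvx g_cvx
  f_max g_max fit (supply_lt I fhat ghat) (fghat_lt I fhat ghat).
have {}c_le := leq_trans c_le (cost_le _ _ _ (ncom_le _ _ _) (nladder_le _ _ _)).
exists r, c; split=> //; last by rewrite qE; apply: leq_trans c_le _; lia.
have [|||_] := run_eval run_c (m := input_size I fhat ghat + b + (term_bits (main gens K)).+1).
- lia.
- by apply: env_fits_mono (input_fits I fhat ghat); lia.
- lia.
apply; rewrite qE.
have := horner_nat_le p (leq_addr b (input_size I fhat ghat)).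
by move: c_le; rewrite -!/(input_size _ _ _); lia.
Qed.
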